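(* Let $\alpha>2$ and let $Z=Z^{(n)}$ be the sparse random matrix $Z_{ij}=X_{ij}Y_{ij}$, where $X$ is the adjacency matrix of the Erdős–Rényi graph $\mathcal G_{n,d/n}$ and $Y$ has i.i.d. Weibull entries with shape parameter $\alpha$ (all as described in the context). Then $$\lim_{n\to\infty}\frac{(\log\log n)^{\frac12-\frac1\alpha}}{(\log n)^{\frac12}}\,\lambda_1(Z)=2^{\frac1\alpha}\,\alpha^{-\frac12}\,(\alpha-2)^{\frac12-\frac1\alpha}$$ in probability.
   Context: $d>0$ is a fixed constant. $X=(X_{ij})_{i,j\in[n]}$ is the adjacency matrix of the Erdős–Rényi graph $\mathcal G_{n,p}$ on vertex set $[n]=\{1,\dots,n\}$ with $p=d/n$. $Y=(Y_{ij})_{i,j\in[n]}$ is a random symmetric matrix, independent of $X$, with $Y_{ii}=0$, $Y_{ij}=Y_{ji}$ and $\{Y_{ij}\}_{1\le i<j\le n}$ i.i.d. with a Weibull distribution with shape parameter $\alpha$ (whose law does not depend on $n$). A random variable $W$ has a Weibull distribution with shape parameter $\alpha>0$ if there exist constants $C_1,C_2>0$ such that for all $t>1$, $\frac{C_1}{2}e^{-t^\alpha}\le \mathbb P(W\ge t)\le\frac{C_2}{2}e^{-t^\alpha}$ and $\frac{C_1}{2}e^{-t^\alpha}\le\mathbb P(W\le -t)\le\frac{C_2}{2}e^{-t^\alpha}$. $Z$ is the entrywise product, $Z_{ij}=X_{ij}Y_{ij}$. $\lambda_1(Z)$ denotes the largest eigenvalue of the symmetric matrix $Z$. *)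

(* Defs.v *)
From HB Require Import structures.
From mathcomp Require Import all_boot all_order all_algebra.
From mathcomp Require Import all_classical all_reals all_analysis.

Set Implicit Arguments.
Unset Strict Implicit.
Unset Printing Implicit Defensive.

Import Order.TTheory GRing.Theory Num.Theory.
Import numFieldNormedType.Exports.

Local Open Scope classical_set_scope.
Local Open Scope ring_scope.

Section independence.
Context {R : realType} {d : measure_display} {T : measurableType d}.
Variable P : probability T R.

Definition mutually_independent {d' : measure_display}
    {T' : measurableType d'} {I : finType} (X : I -> T -> T') : Prop :=
  forall (J : {set I}) (B : I -> set T'), (forall i, measurable (B i)) ->
    P (\bigcap_(i in [set` J]) (X i @^-1` B i)) =
    (\prod_(i in J) P (X i @^-1` B i))%E.

Definition sigma_mx {n : nat} (M : T -> 'M[R]_n) : set (set T) :=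
  <<s \bigcup_(ij in [set: 'I_n * 'I_n])
        preimage_set_system setT (fun w => M w ij.1 ij.2) measurable >>.

Definition independent_mx {n : nat} (M N : T -> 'M[R]_n) : Prop :=
  forall A B : set T, sigma_mx M A -> sigma_mx N B ->
    P (A `&` B) = (P A * P B)%E.

End independence.

Notation upper_pair n := {ij : 'I_n * 'I_n | (ij.1 < ij.2)%N}.

Definition adjacency_mx {R : realType} {n : nat} (e : rel 'I_n) : 'M[R]_n :=
  \matrix_(i, j) (e i j)%:R.

(* The graph is encoded by its adjacency relation, each edge {i, j} being
   represented by the pair i < j. *)
Definition erdos_renyi {R : realType} {d : measure_display}
    {T : measurableType d} (P : probability T R) {n : nat} (p : R)
    (G : T -> rel 'I_n) : Prop :=
  [/\ forall w, symmetric (G w) /\ irreflexive (G w),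
      forall i j, measurable_fun setT (fun w => G w i j),
      forall i j : 'I_n, (i < j)%N -> P [set w | G w i j] = p%:E &
      mutually_independent P
        (fun (e : upper_pair n) w => G w (val e).1 (val e).2)].

Definition weibull {R : realType} (alpha : R)
    (mu : probability (measurableTypeR R) R) : Prop :=
  0 < alpha /\
  exists C1 C2 : R, [/\ 0 < C1, 0 < C2 & forall t : R, 1 < t ->
    let lower := (C1 / 2 * expR (- t `^ alpha))%:E in
    let upper := (C2 / 2 * expR (- t `^ alpha))%:E in
    (lower <= mu [set x : R | (t <= x)%R] <= upper)%E /\
    (lower <= mu [set x : R | (x <= - t)%R] <= upper)%E].

Definition symmetric_iid_mx {R : realType} {d : measure_display}
    {T : measurableType d} (P : probability T R) {n : nat}
    (mu : probability (measurableTypeR R) R) (Y : T -> 'M[R]_n) : Prop :=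
  [/\ forall w i j, Y w i j = Y w j i,
      forall w i, Y w i i = 0,
      forall i j, measurable_fun setT (fun w => Y w i j),
      forall i j : 'I_n, (i < j)%N -> forall A : set R, measurable A ->
        P ((fun w => Y w i j) @^-1` A) = mu A &
      mutually_independent P
        (fun (e : upper_pair n) w => Y w (val e).1 (val e).2)].

Definition entrywise_mul {R : realType} {n : nat} (A B : 'M[R]_n) : 'M[R]_n :=
  map2_mx *%R A B.

(* Used for symmetric matrices of positive size, whose set of eigenvalues is
   finite and nonempty, so that the supremum is a maximum. *)
Definition lambda1 {R : realType} {n : nat} (A : 'M[R]_n) : R :=
  sup [set a : R | eigenvalue A a].

(* The n-th variable lives on its own probability space. *)
Definition cvg_in_probability {R : realType} {d : nat -> measure_display}
    {T : forall n, measurableType (d n)} (P : forall n, probability (T n) R)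
    (U : forall n, T n -> R) (c : R) : Prop :=
  forall eps : R, 0 < eps ->
    P n [set w | eps <= `|U n w - c|] @[n --> \oo] --> 0%E.

(* Main.v *)
Require Import Defs.
From mathcomp Require Import all_boot all_order all_algebra.
From mathcomp Require Import all_classical all_reals all_analysis.
From mathcomp Require Import measurable_realfun.
From mathcomp Require Import ring lra zify.

(** Write [L = ln n] and [M = ln L].  A given vertex has degree [D], of order
    [L / M], with probability about [d^D / D! = exp (- (1 + o(1)) M D)]; giving its
    row the value [S = sum_j |Z_ij|^alpha] costs about [exp (- S)].  With [n]
    vertices at hand, the pairs [(D, S)] that occur are those with
    [S + M D <= (1 + o(1)) L].  The top eigenvalue of the star around the vertex
    is the Euclidean norm of the row, which by convexity is at most
    [S^(1/alpha) D^(1/2 - 1/alpha)], with equality when the weights are equal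
    (here [alpha > 2] matters).  Under the constraint this is maximal for
    [M D = (1 - 2/alpha) L] and [S = (2/alpha) L], and the maximum is
    [lim_const alpha * scale alpha L M], the announced value.

    Upper bound.  Chernoff's bound for [S + M D], all rows at once
    ([row_cost_prob]), and Young's inequality at the optimal scale
    ([row_sqr_le]) bound every row norm sharply.  It remains to compare the
    spectral norm of the matrix with its row norms.  Call hubs the vertices of
    degree at least [eta L / M].  A hub has probability [n^(- c eta)], so hubs do
    not cluster: up to boundedly many edges at each hub, the edges between hubs
    and other vertices form vertex-disjoint stars ([rest_hub_degree]), whose norm
    is exactly a row norm.  The remaining edges form a graph of maximal degree
    [eta L / M], so that its row norms are a small multiple of the scale
    ([subrow_sqr_le]); and since every subgraph of a sparse random graph has
    bounded average degree ([prodPr_not_dense]), peeling off vertices of small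
    degree bounds the spectral norm by a constant times the largest row norm
    ([sparse_norm_le]).  Any constant is good enough there, as [eta] is
    arbitrarily small.

    Lower bound.  Split the vertices into centres and leaves.  The rows of
    distinct centres are independent, and one of them contains, with probability
    tending to one, about [(1 - 2/alpha) L / M] weights that all reach almost
    the optimal common value ([no_star_prob], [no_star_rate]).  The natural test
    vector on such a star gives the lower bound; the edges between its leaves
    contribute at most the average degree times the largest weight, which is of
    smaller order ([lambda1_ge_star]).

    All events but the last one are bounded in the finite product space of
    discretized edge marks, by a single exponential Markov inequality
    ([prodPr_chernoff]), and transferred to the original space by
    [prob_le_prodPr].  The transfer needs the measurability of [lambda1], which
    follows from the Rayleigh characterization [lambda1_leP]. *)

Set Implicit Arguments.
Unset Strict Implicit.
Unset Printing Implicit Defensive.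

Import Order.TTheory GRing.Theory Num.Theory.
Import numFieldNormedType.Exports.

Local Open Scope ring_scope.

(** * Rayleigh quotients and measurability of the largest eigenvalue *)

Definition quad {R : realType} {n : nat} (A : 'M[R]_n) (v : 'I_n -> R) : R :=
  \sum_i \sum_j A i j * (v i * v j).

Definition sqnorm {R : realType} {n : nat} (v : 'I_n -> R) : R :=
  \sum_i v i ^+ 2.

Section Rayleigh.
Local Open Scope classical_set_scope.
Local Open Scope ring_scope.
Context {R : realType} {n : nat}.
Implicit Types (A B : 'M[R]_n) (v : 'I_n -> R) (u : 'rV[R]_n).

Lemma sqnorm_ge0 v : 0 <= sqnorm v.
Proof. by apply: sumr_ge0 => i _; exact: sqr_ge0. Qed.

Lemma sqnorm_gt0 u : u != 0 -> 0 < sqnorm (u 0).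
Proof.
move=> u0; rewrite lt_neqAle sqnorm_ge0 andbT eq_sym.
apply: contra u0; rewrite psumr_eq0 => [/allP h|i _]; last exact: sqr_ge0.
apply/eqP/rowP => i; rewrite mxE; apply/eqP; rewrite -sqrf_eq0.
exact: h (mem_index_enum _).
Qed.

Lemma le_sqnorm v i : v i ^+ 2 <= sqnorm v.
Proof.
by rewrite /sqnorm (bigD1 i)//= lerDl sumr_ge0// => j _; exact: sqr_ge0.
Qed.

Lemma quad_le_absum A v : quad A v <= (\sum_i \sum_j `|A i j|) * sqnorm v.
Proof.
rewrite /quad mulr_suml; apply: ler_sum => i _.
rewrite mulr_suml; apply: ler_sum => j _.
apply: le_trans (ler_norm _) _; rewrite normrM ler_wpM2l// normrM.
have := le_sqnorm v i; have := le_sqnorm v j.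
rewrite -(real_normK (num_real (v i))) -(real_normK (num_real (v j))).
set x := `|v i|; set y := `|v j|; have := sqr_ge0 (x - y); nra.
Qed.

Lemma mulmx_quad A u : (u *m A *m u^T) 0 0 = quad A (u 0).
Proof.
rewrite mxE /quad [RHS]exchange_big /=; apply: eq_bigr => j _.
by rewrite !mxE mulr_suml; apply: eq_bigr => i _; ring.
Qed.

Lemma mulmx_sqnorm u : (u *m u^T) 0 0 = sqnorm (u 0).
Proof. by rewrite mxE; apply: eq_bigr => i _; rewrite !mxE expr2. Qed.

Lemma eigenvalue_le A a x :
  (forall v, quad A v <= x * sqnorm v) -> eigenvalue A a -> a <= x.
Proof.
move=> h /eigenvalueP[u uA u0]; have := h (u 0).
rewrite -mulmx_quad uA -scalemxAl mxE mulmx_sqnorm.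
by rewrite ler_pM2r// sqnorm_gt0.
Qed.

(** The best constant [M] is found as an infimum, without compactness.  If [M]
    were not an eigenvalue, [B = M - A] would be invertible, and expanding
    [0 <= quad B (v - s v B^-1)] shows that [quad B v] is at least a multiple
    of [sqnorm v], so that [M] could be lowered. *)
Lemma lambda1_eigenvalue A : (0 < n)%N -> A^T = A ->
  exists2 M, eigenvalue A M & forall v, quad A v <= M * sqnorm v.
Proof.
move=> n0 symA.
pose U := [set x : R | forall v, quad A v <= x * sqnorm v].
have U0 : U !=set0 by exists (\sum_i \sum_j `|A i j|); exact: quad_le_absum.
have lbU u : u != 0 -> lbound U (quad A (u 0) / sqnorm (u 0)).
  by move=> u0 x /(_ (u 0)); rewrite ler_pdivrMr// sqnorm_gt0.
have [u1 u1N0] : exists u1 : 'rV[R]_n, u1 != 0.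
  exists (delta_mx 0 (Ordinal n0)); apply/eqP => /matrixP/(_ 0 (Ordinal n0)).
  by rewrite !mxE !eqxx => /eqP; rewrite oner_eq0.
have hasU : has_lbound U by eexists; exact: lbU u1N0.
pose M := inf U.
have rowK v : (\row_j v j) 0 = v :> ('I_n -> R) by apply/funext => i; rewrite mxE.
have UM : U M.
  move=> v; have [v0|v0] := eqVneq (\row_j v j) 0.
    have -> : v = fun=> 0 by rewrite -[LHS]rowK v0; apply/funext => i; rewrite mxE.
    rewrite /quad /sqnorm !big1 ?mulr0// => i _; rewrite ?expr0n//.
    by rewrite big1// => j _; rewrite !mulr0.
  have := lb_le_inf U0 (lbU _ v0).
  by rewrite ler_pdivrMr ?sqnorm_gt0// rowK.
exists M; last exact: UM.
case: (boolP (eigenvalue A M)) => // MN; exfalso.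
pose B := M%:M - A.
have unitB : B \in unitmx.
  rewrite -row_free_unit -kermx_eq0.
  move: MN; rewrite /eigenvalue negbK /eigenspace => /eqP kA.
  apply/eqP/row_matrixP => i; rewrite row0.
  have /sub_kermxP : (row i (kermx B) <= kermx B)%MS by exact: row_sub.
  move=> h; apply/eqP; rewrite -submx0 -kA; apply/sub_kermxP.
  by rewrite -[A - _]opprK opprB mulmxN h oppr0.
have symB : B^T = B by rewrite /B linearB/= tr_scalar_mx symA.
have quadB v : quad B v = M * sqnorm v - quad A v.
  rewrite -[in quad B v](rowK v) -[in sqnorm v](rowK v) -[in quad A v](rowK v) -!mulmx_quad -mulmx_sqnorm /B mulmxBr mulmxBl.
  by rewrite mxE [X in _ + X]mxE mul_mx_scalar -scalemxAl mxE.
clearbody B.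
pose C := 1 + \sum_i \sum_j `|(invmx B) i j|.
have C0 : 0 < C.
  by rewrite ltr_pwDl// sumr_ge0// => i _; rewrite sumr_ge0.
have : U (M - C^-1).
  move=> v; rewrite mulrBl lerBrDr -lerBrDl -quadB.
  pose x := \row_j v j; pose y := x *m invmx B.
  have q0 : 0 <= quad B ((x - C^-1 *: y) 0) by rewrite quadB subr_ge0; exact: UM.
  have yB : y *m B = x by rewrite /y mulmxKV.
  have yBx : (y *m B *m x^T) 0 0 = sqnorm v by rewrite yB mulmx_sqnorm rowK.
  have xBy : (x *m B *m y^T) 0 0 = sqnorm v.
    have -> : x *m B *m y^T = (y *m B *m x^T)^T.
      by rewrite !trmx_mul trmxK symB mulmxA.
    by rewrite mxE.
  have yBy : (y *m B *m y^T) 0 0 <= C * sqnorm v.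
    have -> : (y *m B *m y^T) 0 0 = quad (invmx B) v.
      rewrite yB /y trmx_mul trmx_inv symB mulmxA mulmx_quad; congr quad.
      exact: rowK.
    apply: le_trans (quad_le_absum _ _) _.
    by apply: ler_wpM2r; rewrite ?sqnorm_ge0// lerDr.
  have E : quad B ((x - C^-1 *: y) 0) = quad B v - 2 * C^-1 * sqnorm v
      + C^-1 ^+ 2 * (y *m B *m y^T) 0 0.
    rewrite -mulmx_quad.
    have -> : (x - C^-1 *: y)^T = x^T - C^-1 *: y^T by rewrite linearB linearZ.
    rewrite !mulmxBl !mulmxBr -!scalemxAl -!scalemxAr.
    have -> : quad B v = (x *m B *m x^T) 0 0 by rewrite mulmx_quad; congr quad; rewrite rowK.
    move: yBx xBy; set a := (x *m _ *m _); set b := (y *m _ *m x^T).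
    set c := (x *m _ *m _); set e := (y *m _ *m _).
    clearbody a b c e => bE cE.
    rewrite !mxE bE cE; ring.
  move: q0; rewrite E => q0.
  have : C^-1 ^+ 2 * (y *m B *m y^T) 0 0 <= C^-1 * sqnorm v.
    apply: le_trans (ler_wpM2l (sqr_ge0 _) yBy) _.
    by rewrite expr2 -mulrA (mulrA C^-1 C) mulVf ?gt_eqF// mul1r.
  lra.
move/(ge_inf hasU); rewrite -/M => h.
have : 0 < C^-1 by rewrite invr_gt0.
lra.
Qed.

Lemma lambda1_leP A x : (0 < n)%N -> A^T = A ->
  lambda1 A <= x <-> forall v, quad A v <= x * sqnorm v.
Proof.
move=> n0 symA; have [M eM hM] := lambda1_eigenvalue n0 symA.
have -> : lambda1 A = M.
  apply/eqP; rewrite eq_le; apply/andP; split.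
    by apply: ge_sup; [exists M|move=> a; exact: eigenvalue_le].
  by apply: ub_le_sup => //; exists M => a; exact: eigenvalue_le.
split=> [Mx v|h]; last exact: eigenvalue_le eM.
by apply: le_trans (hM v) _; rewrite ler_wpM2r ?sqnorm_ge0.
Qed.

End Rayleigh.

Section LambdaMeasurable.
Local Open Scope classical_set_scope.
Local Open Scope ring_scope.
Context {R : realType} {n : nat}.
Implicit Types (A : 'M[R]_n) (v : 'I_n -> R).

(** The quadratic form is homogeneous and continuous, so a vector witnessing
    that [x] is not an upper bound of the Rayleigh quotients can be rounded,
    after a large dilation, to an integer one. *)
Lemma quad_gt_int A x v : x * sqnorm v < quad A v ->
  exists z : {ffun 'I_n -> int},
    x * sqnorm (fun i => (z i)%:~R : R) < quad A (fun i => (z i)%:~R).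
Proof.
move=> h.
pose z (k : nat) : {ffun 'I_n -> int} := [ffun i => Num.floor (k.+1%:R * v i)].
pose y (k : nat) i : R := (z k i)%:~R / k.+1%:R.
have yv i : (y k i) @[k --> \oo] --> v i.
  apply: (@squeeze_cvgr _ _ _ _ (fun k => v i - k.+1%:R^-1) (fun=> v i));
    [|rewrite -[X in _ --> X]subr0|exact: cvg_cst]; last first.
    by apply: cvgB; [exact: cvg_cst|exact: cvg_harmonic].
  near=> k; rewrite /y /z ffunE.
  have k0 : 0 < k.+1%:R :> R by rewrite ltr0n.
  rewrite ler_pdivlMr// ler_pdivrMr// [v i * _]mulrC floor_le andbT.
  have := floorD1_gt (k.+1%:R * v i); rewrite intrD.
  by rewrite mulrBl mulVf ?gt_eqF// mulrC lerBlDr => /ltW.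
have cvq : quad A (y k) - x * sqnorm (y k) @[k --> \oo] -->
    quad A v - x * sqnorm v.
  apply: cvgB.
    apply: (@cvg_big _ _ (fun a b : R => a + b) 0 xpredT) => [p|i _].
    - by apply: cvgD; [exact: cvg_fst|exact: cvg_snd].
    apply: (@cvg_big _ _ (fun a b : R => a + b) 0 xpredT) => [p|j _].
    - by apply: cvgD; [exact: cvg_fst|exact: cvg_snd].
    by apply: cvgM; [exact: cvg_cst|apply: cvgM; exact: yv].
  apply: cvgM; first exact: cvg_cst.
  apply: (@cvg_big _ _ (fun a b : R => a + b) 0 xpredT) => [p|i _].
  - by apply: cvgD; [exact: cvg_fst|exact: cvg_snd].
  by rewrite expr2; under eq_fun do rewrite expr2; apply: cvgM; exact: yv.
have : \forall k \near \oo, 0 < quad A (y k) - x * sqnorm (y k).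
  by apply: (cvgr_gt _ cvq); rewrite subr_gt0.
case=> N _ /(_ N (leqnn _)) /= hN; exists (z N).
have N0 : 0 < N.+1%:R :> R by rewrite ltr0n.
have yE : (fun i => (z N i)%:~R) = (fun i => N.+1%:R * y N i) :> ('I_n -> R).
  by apply/funext => i; rewrite /y mulrC divfK// gt_eqF.
rewrite yE.
have -> : sqnorm (fun i => N.+1%:R * y N i) = N.+1%:R ^+ 2 * sqnorm (y N).
  by rewrite /sqnorm mulr_sumr; apply: eq_bigr => i _; rewrite exprMn.
have -> : quad A (fun i => N.+1%:R * y N i) = N.+1%:R ^+ 2 * quad A (y N).
  rewrite /quad mulr_sumr; apply: eq_bigr => i _.
  by rewrite mulr_sumr; apply: eq_bigr => j _; ring.
by rewrite mulrCA ltr_pM2l ?exprn_gt0// -subr_gt0.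
Unshelve. all: by end_near. Qed.

(** By the Rayleigh characterization, [lambda1 (M w) > x] is a countable union of
    conditions on the entries, one for each integer vector. *)
Lemma measurable_lambda1 (d : measure_display) (T : measurableType d)
    (M : T -> 'M[R]_n) : (0 < n)%N -> (forall w, (M w)^T = M w) ->
  (forall i j, measurable_fun setT (fun w => M w i j)) ->
  measurable_fun setT (fun w => lambda1 (M w)).
Proof.
move=> n0 symM mM.
apply: (measurability _ (RGenOInfty.measurableE R)) => _ [_ [x ->] <-].
rewrite setTI.
pose E (z : {ffun 'I_n -> int}) := [set w | 0 <
  quad (M w) (fun i => (z i)%:~R) - x * sqnorm (fun i => (z i)%:~R : R)].
rewrite (_ : _ @^-1` _ = \bigcup_(z in setT) E z); last first.
  apply/seteqP; split => w /=; rewrite in_itv/= andbT.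
    move=> xl; have : ~ lambda1 (M w) <= x by apply/negP; rewrite -ltNge.
    move=> /(lambda1_leP _ n0 (symM w)) /existsNP[v /negP]; rewrite -ltNge.
    by move=> /quad_gt_int[z hz]; exists z => //; rewrite /E/= subr_gt0.
  case=> z _; rewrite /E/= subr_gt0 ltNge => /negP h.
  rewrite ltNge; apply/negP => /(lambda1_leP _ n0 (symM w)) h'.
  exact: h (h' _).
apply: countable_bigcupT_measurable; first exact: countableP.
move=> z; rewrite /E.
have mf : measurable_fun setT (fun w =>
    quad (M w) (fun i => (z i)%:~R) - x * sqnorm (fun i => (z i)%:~R : R)).
  apply: measurable_funB => //; apply: measurable_sum => i.
  by apply: measurable_sum => j; apply: measurable_funM.
have := mf measurableT `]0, +oo[%classic (measurable_itv _).
rewrite setTI; congr measurable.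
by apply/seteqP; split => w /=; rewrite in_itv/= andbT.
Qed.

End LambdaMeasurable.

(** * Deterministic norm bounds for sparse weighted graphs *)

Section SparseNorm.
Context {R : realType} {n : nat}.
Implicit Types (A Z : 'M[R]_n) (X : rel 'I_n) (v : 'I_n -> R).

Definition nbrs X (i : 'I_n) : {set 'I_n} := [set j | X i j].

(** A vertex [x] with few neighbours in [S] is peeled off: each of its edges to
    [S] is charged, through [2 a b <= tau a^2 + tau^-1 b^2], partly to [x], at
    most [b] times, and partly to the row of the other endpoint. *)
Lemma sparse_bilinear_le X A v (b : nat) (tau : R) : 0 < tau ->
  A^T = A -> (forall i j, 0 <= A i j) -> (forall i, A i i = 0) ->
  (forall i j, ~~ X i j -> A i j = 0) ->
  (forall S : {set 'I_n}, (0 < #|S|)%N ->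
    exists2 x, x \in S & (#|nbrs X x :&: S| <= b)%N) ->
  forall S : {set 'I_n},
  \sum_(i in S) \sum_(j in S) A i j * (`|v i| * `|v j|) <=
  \sum_(i in S) (tau * b%:R * v i ^+ 2 +
    tau^-1 * v i ^+ 2 * \sum_(j in S) A i j ^+ 2).
Proof.
move=> tau0 symA A0 Aii AX hb S.
have AC i j : A i j = A j i by rewrite -[in LHS]symA mxE.
have [k] := ubnP #|S|; elim: k S => // k IH S; rewrite ltnS => Sk.
have [/cards0_eq->|S0] := posnP #|S|; first by rewrite !big_set0.
have [x xS xb] := hb _ S0.
rewrite -(finset.setD1K xS).
set T := S :\ x; have xT : x \notin T by rewrite !inE eqxx.
have {}IH : \sum_(i in T) \sum_(j in T) A i j * (`|v i| * `|v j|) <=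
  \sum_(i in T) (tau * b%:R * v i ^+ 2 +
    tau^-1 * v i ^+ 2 * \sum_(j in T) A i j ^+ 2).
  by apply: IH; apply: leq_trans Sk; rewrite (cardsD1 x S) xS.
have split_sum (F : 'I_n -> R) : \sum_(i in x |: T) F i = F x + \sum_(i in T) F i.
  by rewrite big_setU1.
rewrite !split_sum Aii mul0r add0r.
have -> : \sum_(i in T) \sum_(j in x |: T) A i j * (`|v i| * `|v j|) =
    \sum_(j in T) A x j * (`|v x| * `|v j|) +
    \sum_(i in T) \sum_(j in T) A i j * (`|v i| * `|v j|).
  rewrite -big_split/=; apply: eq_bigr => i _.
  by rewrite split_sum (AC i x) [`|v x| * _]mulrC.
have -> : \sum_(i in T) (tau * b%:R * v i ^+ 2 +
    tau^-1 * v i ^+ 2 * \sum_(j in x |: T) A i j ^+ 2) =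
   \sum_(i in T) (tau * b%:R * v i ^+ 2 +
    tau^-1 * v i ^+ 2 * \sum_(j in T) A i j ^+ 2) +
    \sum_(i in T) tau^-1 * v i ^+ 2 * A x i ^+ 2.
  rewrite -big_split/=; apply: eq_bigr => i _.
  by rewrite split_sum (AC i x); ring.
set P := \sum_(i in T) _ in IH *; set Q := \sum_(i in T) _ in IH *.
suff : \sum_(j in T) A x j * (`|v x| * `|v j|) +
    \sum_(j in T) A x j * (`|v x| * `|v j|) <=
    tau * b%:R * v x ^+ 2 + \sum_(i in T) tau^-1 * v i ^+ 2 * A x i ^+ 2.
  have : 0 <= tau^-1 * v x ^+ 2 * (A x x ^+ 2 + \sum_(j in T) A x j ^+ 2).
    rewrite mulr_ge0//; first by rewrite mulr_ge0 ?sqr_ge0// invr_ge0 ltW.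
    by rewrite addr_ge0 ?sqr_ge0// sumr_ge0// => j _; exact: sqr_ge0.
  rewrite Aii; lra.
rewrite -big_split/=.
apply: (@le_trans _ _ (\sum_(j in T) ((X x j)%:R * (tau * v x ^+ 2) +
    tau^-1 * v j ^+ 2 * A x j ^+ 2))).
  apply: ler_sum => j _; case: (boolP (X x j)) => [_|/AX ->]; last first.
    by rewrite !mul0r expr0n/= mulr0 !addr0.
  rewrite mul1r -(real_normK (num_real (v x))) -(real_normK (num_real (v j))).
  set p := `|v x|; set q := `|v j|.
  have := sqr_ge0 (tau * p - A x j * q) => h.
  have : 0 <= tau^-1 * (tau * p - A x j * q) ^+ 2.
    by rewrite mulr_ge0// invr_ge0 ltW.
  have -> : tau^-1 * (tau * p - A x j * q) ^+ 2 =
      tau * p ^+ 2 - 2 * (A x j * (p * q)) + tau^-1 * q ^+ 2 * A x j ^+ 2.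
    by field; rewrite gt_eqF.
  lra.
rewrite big_split/= lerD2r -mulr_suml [leRHS]mulrAC [leRHS]mulrC.
apply: ler_wpM2r.
  by rewrite mulr_ge0 ?sqr_ge0// ltW.
rewrite -natr_sum ler_nat.
apply: leq_trans xb; rewrite -big_mkcondr/= sum1_card.
apply/subset_leq_card/fintype.subsetP => j.
by rewrite unfold_in /T !inE => /andP[/andP[_ ->] ->].
Qed.
End SparseNorm.

Section UpperDet.
Context {R : realType} {n : nat}.
Implicit Types (A Z : 'M[R]_n) (X : rel 'I_n) (v : 'I_n -> R) (H : {set 'I_n}).

Definition density_le X (b : nat) : Prop :=
  forall S : {set 'I_n}, (\sum_(i in S) #|nbrs X i :&: S| <= b * #|S|)%N.

(** The minimum degree of a graph is at most its average degree. *)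
Lemma density_min_degree X b (S : {set 'I_n}) : density_le X b -> (0 < #|S|)%N ->
  exists2 x, x \in S & (#|nbrs X x :&: S| <= b)%N.
Proof.
move=> hb S0; apply/exists_inP; apply: contraPT (hb S).
move=> /exists_inPn h; apply/negP; rewrite -ltnNge.
have : (\sum_(i in S) b.+1 <= \sum_(i in S) #|nbrs X i :&: S|)%N.
  by apply: leq_sum => i /h; rewrite -ltnNge.
apply: leq_trans; rewrite sum_nat_const mulnS mulnC.
by rewrite -[X in (X < _)%N]add0n ltn_add2r.
Qed.

(** Optimizing [tau] in [sparse_bilinear_le]: for a graph all of whose subgraphs
    have average degree at most [b], the norm is at most [2 sqrt b] times the
    largest row norm. *)
Lemma sparse_norm_le X A v (b : nat) (rho2 kappa : R) :
  0 < kappa -> (0 < b)%N -> 4 * b%:R * rho2 <= kappa ^+ 2 ->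
  A^T = A -> (forall i j, 0 <= A i j) -> (forall i, A i i = 0) ->
  (forall i j, ~~ X i j -> A i j = 0) -> density_le X b ->
  (forall i, \sum_j A i j ^+ 2 <= rho2) ->
  \sum_i \sum_j A i j * (`|v i| * `|v j|) <= kappa * sqnorm v.
Proof.
move=> k0 b0 hk symA A0 Aii AX hb hrow.
have bR0 : 0 < b%:R :> R by rewrite ltr0n.
have tau0 : 0 < kappa / (2 * b%:R) by rewrite divr_gt0// mulr_gt0.
have := sparse_bilinear_le v tau0 symA A0 Aii AX
  (fun S => density_min_degree hb) [set: 'I_n]%SET.
under eq_bigl do rewrite finset.in_setT.
under eq_bigr do (under eq_bigl do rewrite finset.in_setT).
move/le_trans; apply.
under eq_bigl do rewrite finset.in_setT.
under eq_bigr do (under eq_bigl do rewrite finset.in_setT).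
rewrite /sqnorm mulr_sumr; apply: ler_sum => i _.
rewrite [X in _ + X]mulrAC [X in _ + X]mulrC [X in _ + X]mulrC -mulrDl.
rewrite ler_wpM2r ?sqr_ge0//.
have -> : kappa / (2 * b%:R) * b%:R = kappa / 2 by field; rewrite gt_eqF.
suff : (kappa / (2 * b%:R))^-1 * \sum_(j < n) A i j ^+ 2 <= kappa / 2 by lra.
rewrite invf_div mulrAC ler_pdivrMr//.
have := hrow i; set r := \sum_(j < n) _ => hr.
have : b%:R * r <= b%:R * rho2 by rewrite ler_wpM2l// ltW.
by rewrite expr2 in hk *; lra.
Qed.

(** The hubs will be [H]; a vertex outside [H] adjacent to a single hub is a leaf
    of the star of that hub, so distinct stars are disjoint. *)
Definition star X H (h u : 'I_n) : bool :=
  [&& h \in H, u \notin H, X h u &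
      [forall h', (h' \in H) && X h' u ==> (h' == h)]].

Definition rest X H (i j : 'I_n) : bool :=
  [&& X i j, ~~ star X H i j & ~~ star X H j i].

Lemma star_uniq X H h h' u : star X H h u -> star X H h' u -> h = h'.
Proof.
move=> /and4P[hH _ hu _] /and4P[_ _ _ /forallP/(_ h)].
by rewrite hH hu => /eqP.
Qed.

(** The stars are vertex disjoint, so their norm is the largest row norm. *)
Lemma star_norm_le X H A v (rho : R) : 0 < rho ->
  (forall i j, 0 <= A i j) ->
  (forall i, \sum_j A i j ^+ 2 <= rho ^+ 2) ->
  \sum_h \sum_u (star X H h u)%:R * (2 * (A h u * (`|v h| * `|v u|))) <=
  rho * sqnorm v.
Proof.
move=> rho0 A0 hrow.
apply: (@le_trans _ _ (\sum_h \sum_u (star X H h u)%:R *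
    (rho^-1 * A h u ^+ 2 * v h ^+ 2 + rho * v u ^+ 2))).
  apply: ler_sum => h _; apply: ler_sum => u _; rewrite ler_wpM2l//.
  rewrite -(real_normK (num_real (v h))) -(real_normK (num_real (v u))).
  set p := `|v h|; set q := `|v u|.
  have := sqr_ge0 (A h u * p - rho * q) => h0.
  have : 0 <= rho^-1 * (A h u * p - rho * q) ^+ 2.
    by rewrite mulr_ge0// invr_ge0 ltW.
  have -> : rho^-1 * (A h u * p - rho * q) ^+ 2 =
      rho^-1 * A h u ^+ 2 * p ^+ 2 + rho * q ^+ 2 - 2 * (A h u * (p * q)).
    by field; rewrite gt_eqF.
  lra.
under eq_bigr do (under eq_bigr do rewrite mulrDr; rewrite big_split/=).
rewrite big_split/= [X in _ + X]exchange_big/= -big_split/=.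
rewrite /sqnorm mulr_sumr; apply: ler_sum => i _.
have [iH|iH] := boolP (i \in H).
  rewrite [X in _ + X]big1 ?addr0 => [|h _]; last first.
    by rewrite /star iH /= andbF mul0r.
  apply: (@le_trans _ _ (\sum_j rho^-1 * A i j ^+ 2 * v i ^+ 2)).
    apply: ler_sum => j _; rewrite ler_piMl ?lern1 ?leq_b1//.
    by rewrite mulr_ge0 ?sqr_ge0// mulr_ge0 ?sqr_ge0// invr_ge0 ltW.
  rewrite -mulr_suml ler_wpM2r ?sqr_ge0// -mulr_sumr mulrC ler_pdivrMr// -expr2.
rewrite [X in X + _]big1 ?add0r => [|h _]; last by rewrite /star (negbTE iH) mul0r.
have [h0 sh0|nos] := pickP (fun h => star X H h i); last first.
  rewrite big1 => [|h _]; last by rewrite nos mul0r.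
  by rewrite mulr_ge0 ?sqr_ge0// ltW.
rewrite (bigD1 h0)//= sh0 mul1r big1 ?addr0// => h /eqP hh0.
have [sh|] := boolP (star X H h i); last by rewrite mul0r.
by case: hh0; exact: star_uniq sh sh0.
Qed.

(** Splitting [Z] into the vertex-disjoint stars centred at [H] and the rest:
    the sharp constant comes from the stars, and the rest only has to be
    bounded up to a constant. *)
Lemma quad_le_star_rest X H Z v (b : nat) (rho rho2 kappa : R) :
  0 < rho -> 0 < kappa -> (0 < b)%N -> 4 * b%:R * rho2 <= kappa ^+ 2 ->
  symmetric X -> irreflexive X ->
  Z^T = Z -> (forall i j, ~~ X i j -> Z i j = 0) -> density_le X b ->
  (forall i, \sum_j Z i j ^+ 2 <= rho ^+ 2) ->
  (forall i, \sum_(j | rest X H i j) Z i j ^+ 2 <= rho2) ->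
  quad Z v <= (rho + kappa) * sqnorm v.
Proof.
move=> rho0 k0 b0 hk symX irrX symZ ZX hb hrow hrest.
have ZC i j : Z i j = Z j i by rewrite -[in LHS]symZ mxE.
pose A := \matrix_(i, j) `|Z i j|.
pose B := \matrix_(i, j) ((rest X H i j)%:R * `|Z i j|).
have sXr i j : rest X H i j = rest X H j i.
  by rewrite /rest symX [X in _ && X]andbC.
have hB : \sum_i \sum_j B i j * (`|v i| * `|v j|) <= kappa * sqnorm v.
  apply: (sparse_norm_le (X := X) v k0 b0 hk) => //.
  - by apply/matrixP => i j; rewrite !mxE sXr ZC.
  - by move=> i j; rewrite mxE mulr_ge0.
  - by move=> i; rewrite mxE /rest irrX mul0r.
  - by move=> i j /ZX Z0; rewrite mxE Z0 normr0 mulr0.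
  - move=> i; apply: le_trans (hrest i).
    rewrite [leRHS]big_mkcond/=; apply: ler_sum => j _; rewrite mxE.
    by case: ifP; rewrite ?mul1r ?mul0r ?expr0n// real_normK// num_real.
have hA : \sum_h \sum_u (star X H h u)%:R * (2 * (A h u * (`|v h| * `|v u|))) <=
    rho * sqnorm v.
  apply: star_norm_le => // [i j|i]; first by rewrite mxE.
  apply: le_trans (hrow i); apply: ler_sum => j _.
  by rewrite mxE real_normK// num_real.
rewrite mulrDl; apply: le_trans (lerD hA hB).
have -> : \sum_h \sum_u (star X H h u)%:R * (2 * (A h u * (`|v h| * `|v u|))) =
  \sum_h \sum_u ((star X H h u)%:R + (star X H u h)%:R) *
    (A h u * (`|v h| * `|v u|)).
  under eq_bigr do under eq_bigr do rewrite mulrCA mulrDl mul1r.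
  under eq_bigr do (rewrite big_split/=).
  under [RHS]eq_bigr do under eq_bigr do rewrite mulrDl.
  under [RHS]eq_bigr do (rewrite big_split/=).
  rewrite big_split/= [RHS]big_split/=; congr (_ + _).
  rewrite exchange_big/=; apply: eq_bigr => i _; apply: eq_bigr => j _.
  by rewrite !mxE ZC [`|v j| * _]mulrC.
rewrite -big_split/=; apply: ler_sum => i _.
rewrite -big_split/=; apply: ler_sum => j _.
rewrite !mxE; apply: le_trans (ler_norm _) _; rewrite !normrM.
set t := `|Z i j| * (_ * _).
have t0 : 0 <= t by rewrite !mulr_ge0.
rewrite -mulrA -/t -mulrDl -[leLHS]mul1r.
have [XX|/ZX Z0] := boolP (X i j); last by rewrite /t Z0 normr0 !(mul0r, mulr0).
rewrite ler_wpM2r// /rest XX /= -!natrD ler1n.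
by case: (star X H i j); case: (star X H j i).
Qed.

End UpperDet.

Lemma inj_ffun_in (T : finType) (S : {set T}) r : (r <= #|S|)%N ->
  exists2 f : {ffun 'I_r -> T}, injective f & forall k, f k \in S.
Proof.
move=> rS; exists [ffun k => enum_val (widen_ord rS k)].
  move=> k l; rewrite !ffunE => /enum_val_inj/(congr1 val)/= kl.
  exact: val_inj.
by move=> k; rewrite ffunE enum_valP.
Qed.

Section RestDegree.
Context {n : nat}.
Implicit Types (X : rel 'I_n) (H : {set 'I_n}).

Definition codegree_le2 X : Prop :=
  forall x y, x != y -> (#|nbrs X x :&: nbrs X y| <= 2)%N.

(** The two clusters of hubs to be excluded: many hubs next to [h], and many hubs
    at distance two from [h] through distinct midpoints.  Their vertices are
    required to be distinct so that their edges can be counted. *)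
Definition hub_star X H r (h : 'I_n) (f : {ffun 'I_r -> 'I_n}) : Prop :=
  [/\ injective f, forall k, X h (f k) & forall k, f k \in H].

Definition hub_spider X H r (h : 'I_n) (u w : {ffun 'I_r -> 'I_n}) : Prop :=
  [/\ [/\ injective u, injective w, forall k l, u k != w l,
       forall k, h != u k & forall k, h != w k],
      forall k, X h (u k), forall k, X (u k) (w k) & forall k, w k \in H].

(** A neighbour of [h] whose edge to [h] is not in a star is either itself in
    [H] or is adjacent to a second vertex of [H]; in the latter case bounded
    codegrees allow to extract a spider. *)
Lemma rest_hub_degree X H r h : symmetric X -> irreflexive X ->
  codegree_le2 X ->
  (forall h f, ~ @hub_star X H r h f) ->
  (forall h u w, ~ @hub_spider X H r h u w) ->
  h \in H -> (#|[set j | rest X H h j]| <= 3 * r)%N.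
Proof.
move=> symX irrX C0 C1 C2 hH.
pose U := nbrs X h :&: H.
pose g (u : 'I_n) := odflt h [pick h' | [&& h' \in H, X h' u & h' != h]].
pose W := [set u | [&& X h u, u \notin H & g u != h]].
have gP u : g u != h -> (g u \in H) && X (g u) u.
  rewrite /g; case: pickP => [h' /and3P[-> -> _]//|_ /=]; by rewrite eqxx.
have Ur : (#|U| <= r)%N.
  rewrite leqNgt; apply/negP => /ltnW /inj_ffun_in[f finj fU].
  apply: (C1 h f); split => // k; first by move: (fU k); rewrite !inE => /andP[].
  by move: (fU k); rewrite !inE => /andP[].
have Wg : (#|W| <= #|g @: W| * 2)%N.
  rewrite -sum1_card (partition_big_imset g)/= -sum_nat_const.
  apply: leq_sum => y /imsetP[u0]; rewrite !inE => /and3P[_ _ g0] ->.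
  have h0 : h != g u0 by rewrite eq_sym.
  apply: leq_trans (C0 _ _ h0); rewrite sum1_card.
  apply/subset_leq_card/fintype.subsetP => u.
  rewrite unfold_in !inE => /andP[/and3P[hu _ gu] /eqP guu0].
  by rewrite hu -guu0; case/andP: (gP _ gu).
have Wr : (#|g @: W| <= r)%N.
  rewrite leqNgt; apply/negP => /ltnW /inj_ffun_in[w winj wW].
  have /fin_all_exists[u0 hu0] : forall k, exists u, u \in W /\ w k = g u.
    by move=> k; have /imsetP[u uW ->] := wW k; exists u.
  pose u := [ffun k => u0 k].
  have hu k : [/\ X h (u k), u k \notin H, g (u k) != h & w k = g (u k)].
    by rewrite ffunE; have [] := hu0 k; rewrite inE => /and3P[].
  apply: (C2 h u w); split.
  - split => //.
    + by move=> k l kl; apply: winj; have [_ _ _ ->] := hu k; have [_ _ _ ->] := hu l; rewrite kl.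
    + move=> k l; have [_ _ gl wl] := hu l; have [_ nH _ _] := hu k.
      by apply: contraNneq nH => ->; rewrite wl; case/andP: (gP _ gl).
    + by move=> k; have [_ nH _ _] := hu k; apply: contraNneq nH => <-.
    + by move=> k; have [_ _ gl ->] := hu k; rewrite eq_sym.
  - by move=> k; have [] := hu k.
  - by move=> k; have [_ _ gk ->] := hu k; rewrite symX; case/andP: (gP _ gk).
  - by move=> k; have [_ _ gk ->] := hu k; case/andP: (gP _ gk).
have sub : [set j | rest X H h j] \subset U :|: W.
  apply/fintype.subsetP => j; rewrite !inE /rest => /and3P[hj + _].
  rewrite hj /=; have [//|jH] := boolP (j \in H).
  rewrite /star hH jH hj /= => /forallPn[h']; rewrite negb_imply => /andP[h'P hh'].
  rewrite /g; case: pickP => [y /and3P[_ _]//|/(_ h')].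
  by case/andP: h'P => -> ->; rewrite hh'.
apply: leq_trans (subset_leq_card sub) _.
apply: leq_trans (leq_card_setU _ _).1 _.
apply: leq_trans (leq_add Ur Wg) _.
by rewrite mulSn leq_add2l mulnC leq_pmul2l.
Qed.

Lemma rest_degree X H i : (#|[set j | rest X H i j]| <= #|nbrs X i|)%N.
Proof.
by apply/subset_leq_card/fintype.subsetP => j; rewrite !inE => /and3P[].
Qed.

End RestDegree.

Section RowYoung.
Context {R : realType}.

(** Young's inequality with a free scale [s]; it turns a bound on
    [sum y^alpha] and on the number of terms into a bound on [sum y^2], and is
    an equality when all the [y]'s are equal to [s]. *)
Lemma young_scale (alpha s y : R) : 2 < alpha -> 0 < s -> 0 <= y ->
  y ^+ 2 <= s ^+ 2 * (2 / alpha * (y `^ alpha / s `^ alpha) + (1 - 2 / alpha)).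
Proof.
move=> a2 s0 y0; have a0 : 0 < alpha by lra.
have k0 : 0 < 1 - 2 / alpha by rewrite subr_gt0 ltr_pdivrMr// mul1r.
have p0 : 0 < alpha / 2 by lra.
have q0 : 0 < (1 - 2 / alpha)^-1 by rewrite invr_gt0.
have pq : (alpha / 2)^-1 + (1 - 2 / alpha)^-1^-1 = 1.
  by rewrite invrK invf_div addrCA subrr addr0.
have x0 : 0 <= (y / s) ^+ 2 by exact: sqr_ge0.
have := conjugate_powR x0 ler01 p0 q0 pq.
rewrite mulr1 powR1 invrK mul1r.
have ys0 : 0 <= y / s by rewrite divr_ge0// ltW.
have -> : ((y / s) ^+ 2) `^ (alpha / 2) = y `^ alpha / s `^ alpha.
  rewrite -powR_mulrn// -powRrM mulrCA divff ?mulr1; last by rewrite pnatr_eq0.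
  by rewrite powRM// ?invr_ge0 ?(ltW s0)// -powR_inv1 ?(ltW s0)// -powRrM mulN1r powRN.
rewrite invf_div [X in _ <= X + _]mulrC => h.
rewrite -ler_pdivrMl ?exprn_gt0//.
by apply: le_trans h; rewrite expr_div_n mulrC.
Qed.

(** Leaving [s] free replaces an optimization over the pair (sum, number of
    terms) by a bound that is linear in both. *)
Lemma sum_sqr_row (I : finType) (Q : pred I) (y : I -> R) (alpha s : R) :
  2 < alpha -> 0 < s ->
  \sum_(j | Q j) y j ^+ 2 <=
    s ^+ 2 * (2 / alpha * (\sum_(j | Q j) `|y j| `^ alpha) / s `^ alpha +
             (1 - 2 / alpha) * (\sum_(j | Q j) 1)).
Proof.
move=> a2 s0; rewrite !mulr_sumr mulr_suml -big_split/= mulr_sumr.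
apply: ler_sum => j _; rewrite mulr1 -[X in X + _]mulrA.
by rewrite -real_normK ?num_real//; exact: young_scale.
Qed.

End RowYoung.

Section LowerDet.
Context {R : realType} {n : nat}.
Implicit Types (Z : 'M[R]_n) (X : rel 'I_n).

(** The test vector is [sqrt #|S|] at the centre and [1] on the leaves [S]. *)
Lemma lambda1_ge_star X Z (b : nat) (c : 'I_n) (S : {set 'I_n}) (t y : R) :
  Z^T = Z -> (forall i j, ~~ X i j -> Z i j = 0) -> Z c c = 0 ->
  density_le X b -> (0 < #|S|)%N -> c \notin S -> 0 <= y ->
  (forall i j, i \in S -> j \in S -> `|Z i j| <= y) ->
  (forall u, u \in S -> t <= Z c u) ->
  Num.sqrt #|S|%:R * t - b%:R * y <= lambda1 Z.
Proof.
move=> symZ ZX Zcc hb S0 cS y0 hy ht.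
have n0 : (0 < n)%N by exact: leq_trans (ltn_ord c).
have ZC i j : Z i j = Z j i by rewrite -[in LHS]symZ mxE.
set k : R := #|S|%:R; have k0 : 0 < k by rewrite ltr0n.
set s := Num.sqrt k; have s0 : 0 < s by rewrite sqrtr_gt0.
have s2 : s * s = k by rewrite -expr2 sqr_sqrtr// ltW.
pose v i := if i == c then s else (i \in S)%:R.
have vc : v c = s by rewrite /v eqxx.
have vN i : i != c -> v i = (i \in S)%:R by rewrite /v => /negbTE ->.
have sumS (F : 'I_n -> R) : \sum_(i < n | i != c) (i \in S)%:R * F i = \sum_(i in S) F i.
  rewrite big_mkcond [RHS]big_mkcond/=; apply: eq_bigr => i _.
  have [->|] := eqVneq i c; first by rewrite (negbTE cS).
  by case: ifP; rewrite ?mul1r ?mul0r.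
have nv : sqnorm v = 2 * k.
  rewrite /sqnorm (bigD1 c)//= vc expr2 s2.
  have -> : \sum_(i < n | i != c) v i ^+ 2 = \sum_(i in S) 1.
    rewrite -sumS; apply: eq_bigr => i ic; rewrite vN// mulr1.
    by case: (i \in S); rewrite ?expr1n ?expr0n.
  by rewrite sumr_const -/k; lra.
have qv : quad Z v = 2 * (s * \sum_(i in S) Z c i) + \sum_(i in S) \sum_(j in S) Z i j.
  have rowE i : \sum_j Z i j * (v i * v j) = v i * (Z i c * s + \sum_(j in S) Z i j).
    rewrite (bigD1 c)//= vc mulrDr mulr_sumr -sumS; congr (_ + _); first by ring.
    by apply: eq_bigr => j jc; rewrite (vN j)//; ring.
  rewrite /quad (eq_bigr _ (fun i _ => rowE i)) (bigD1 c)//= vc Zcc mul0r add0r.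
  have -> : \sum_(i < n | i != c) v i * (Z i c * s + \sum_(j in S) Z i j) =
      \sum_(i in S) (Z i c * s + \sum_(j in S) Z i j).
    by rewrite -sumS; apply: eq_bigr => i ic; rewrite vN.
  rewrite big_split/= -mulr_suml.
  by under [X in _ + (X * _ + _) = _]eq_bigr do rewrite ZC; ring.
have inner : - (b%:R * k * y) <= \sum_(i in S) \sum_(j in S) Z i j.
  rewrite lerNl -sumrN.
  apply: (@le_trans _ _ (\sum_(i in S) (#|nbrs X i :&: S|)%:R * y)).
    apply: ler_sum => i iS; rewrite -sumrN.
    rewrite -sumr_const mulr_suml [leRHS]big_mkcond [leLHS]big_mkcond/=.
    apply: ler_sum => j _; rewrite !inE.
    case: (boolP (j \in S)) => jS; last by rewrite andbF.
    rewrite andbT; case: (boolP (X i j)) => [_|/ZX ->]; last by rewrite oppr0.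
    by rewrite mul1r; apply: le_trans (hy i j iS jS); rewrite -normrN ler_norm.
  rewrite -mulr_suml ler_wpM2r// -natr_sum -natrM ler_nat; exact: hb.
have outer : k * t <= \sum_(i in S) Z c i.
  by rewrite /k mulr_natl -sumr_const; apply: ler_sum => i /ht.
have /(_ v) := (lambda1_leP (lambda1 Z) n0 symZ).1 (lexx _).
rewrite nv qv => h.
rewrite -(ler_pM2r (mulr_gt0 (ltr0Sn R 1) k0)).
have : s * (k * t) <= s * \sum_(i in S) Z c i by rewrite ler_wpM2l// ltW.
have : 0 <= b%:R * k * y by rewrite !mulr_ge0// ltW.
lra.
Qed.
End LowerDet.

(** * The limiting constant *)

Section Constants.
Context {R : realType}.
Implicit Types alpha L M : R.

Lemma powR_expR (x a : R) : 0 < x -> x `^ a = expR (a * ln x).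
Proof. by move=> x0; rewrite /powR gt_eqF. Qed.

Definition lim_const alpha : R :=
  2 `^ (1 / alpha) * alpha `^ (- (1 / 2)) * (alpha - 2) `^ (1 / 2 - 1 / alpha).

Definition scale alpha L M : R := L `^ (1 / 2) / M `^ (1 / 2 - 1 / alpha).

Lemma lim_const_gt0 alpha : 2 < alpha -> 0 < lim_const alpha.
Proof. by move=> a2; rewrite !mulr_gt0// powR_gt0//; lra. Qed.

Lemma scale_gt0 alpha L M : 0 < L -> 0 < M -> 0 < scale alpha L M.
Proof. by move=> L0 M0; rewrite divr_gt0// powR_gt0. Qed.

Lemma scale_sqr alpha L M : 2 < alpha -> 0 < L -> 0 < M ->
  scale alpha L M ^+ 2 = L * M `^ (- (1 - 2 / alpha)).
Proof.
move=> a2 L0 M0; rewrite /scale -powRN !powR_expR// -expRD -expRM_natl.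
rewrite -[X in _ = X * _](@lnK R)// -expRD; congr expR; field.
by rewrite gt_eqF//; lra.
Qed.

Lemma lim_const_sqr alpha : 2 < alpha ->
  lim_const alpha ^+ 2 =
  (1 - 2 / alpha) `^ (1 - 2 / alpha) * (2 / alpha) `^ (2 / alpha).
Proof.
move=> a2; have a0 : 0 < alpha by lra.
have k0 : 0 < 1 - 2 / alpha by rewrite subr_gt0 ltr_pdivrMr// mul1r.
have -> : (1 - 2 / alpha) `^ (1 - 2 / alpha) =
    ((alpha - 2) / alpha) `^ (1 - 2 / alpha).
  by congr (_ `^ _); field; rewrite gt_eqF.
rewrite /lim_const !powR_expR ?divr_gt0//; try lra.
rewrite !ln_div ?posrE//; try lra.
rewrite -!expRD -expRM_natl; congr expR; field; by rewrite gt_eqF.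
Qed.

(** The left-hand side is the value at [S + M D = 1] of the bound of
    [sum_sqr_row] for the scale [s] such that [s^alpha = 2 M / (alpha - 2)]: this
    is the scale at which [S] and [M D] enter that bound with equal weights. *)
Lemma lim_scale alpha M : 2 < alpha -> 0 < M ->
  (2 * M / (alpha - 2)) `^ (2 / alpha) * (1 - 2 / alpha) / M =
  lim_const alpha ^+ 2 * M `^ (- (1 - 2 / alpha)).
Proof.
move=> a2 M0; have a0 : 0 < alpha by lra.
have k0 : 0 < 1 - 2 / alpha by rewrite subr_gt0 ltr_pdivrMr// mul1r.
rewrite lim_const_sqr//.
have E : 1 - 2 / alpha = (alpha - 2) / alpha by field; rewrite gt_eqF.
rewrite E; have b0 : 0 < alpha - 2 by lra.
rewrite !powR_expR ?divr_gt0 ?mulr_gt0//.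
rewrite -[X in _ * X / _ = _](@lnK R) ?posrE ?divr_gt0// -[X in _ / X = _](@lnK R) ?posrE//.
rewrite -expRN -!expRD; congr expR.
rewrite !ln_div ?posrE ?mulr_gt0// lnM ?posrE//.
field; by rewrite gt_eqF.
Qed.

End Constants.

Section AnalyticBounds.
Context {R : realType} {n : nat}.
Implicit Types (Z : 'M[R]_n) (X : rel 'I_n) (alpha L M : R).

Lemma sum_nbrs X (i : 'I_n) : \sum_(j | X i j) (1 : R) = #|nbrs X i|%:R.
Proof. by rewrite sumr_const; congr (_ *+ _); apply: eq_card => j; rewrite !inE. Qed.

Lemma row_sqr_le X Z alpha L M (delta : R) (i : 'I_n) : 2 < alpha -> 0 < L -> 0 < M ->
  0 <= delta ->
  (forall j, ~~ X i j -> Z i j = 0) ->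
  \sum_(j | X i j) `|Z i j| `^ alpha + M * #|nbrs X i|%:R <= (1 + delta) * L ->
  \sum_j Z i j ^+ 2 <= ((1 + delta) * (lim_const alpha * scale alpha L M)) ^+ 2.
Proof.
move=> a2 L0 M0 d0 ZX; rewrite -sum_nbrs; set S := \sum_(j | _) _; set D := \sum_(j | _) _ => h.
have a0 : 0 < alpha by lra.
pose s := (2 * M / (alpha - 2)) `^ alpha^-1.
have b0 : 0 < 2 * M / (alpha - 2) by rewrite divr_gt0 ?mulr_gt0//; lra.
have s0 : 0 < s by rewrite powR_gt0.
have sa : s `^ alpha = 2 * M / (alpha - 2).
  by rewrite -powRrM mulVf ?gt_eqF// powRr1 ?ltW.
have s2 : s ^+ 2 = (2 * M / (alpha - 2)) `^ (2 / alpha).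
  by rewrite -powR_mulrn ?ltW// -powRrM [alpha^-1 * _]mulrC.
have -> : \sum_j Z i j ^+ 2 = \sum_(j | X i j) Z i j ^+ 2.
  rewrite [RHS]big_mkcond; apply: eq_bigr => j _.
  by case: ifPn => // /ZX ->; rewrite expr0n.
apply: le_trans (sum_sqr_row _ _ a2 s0) _; rewrite -/S -/D sa s2.
have -> : 2 / alpha * S / (2 * M / (alpha - 2)) + (1 - 2 / alpha) * D =
    (1 - 2 / alpha) / M * (S + M * D).
  by field; rewrite !gt_eqF//; lra.
rewrite [leLHS](_ : _ = (2 * M / (alpha - 2)) `^ (2 / alpha) * (1 - 2 / alpha) / M *
  (S + M * D)); last by ring.
rewrite lim_scale//.
rewrite [leRHS](_ : _ = (1 + delta) ^+ 2 *
  (lim_const alpha ^+ 2 * scale alpha L M ^+ 2)); last by ring.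
rewrite scale_sqr//.
have c0 : 0 <= lim_const alpha ^+ 2 * M `^ (- (1 - 2 / alpha)).
  by rewrite mulr_ge0 ?sqr_ge0// powR_ge0.
apply: le_trans (ler_wpM2l c0 h) _.
set x := _ ^+ 2; set y := _ `^ _ in c0 *.
rewrite [leRHS](_ : _ = (1 + delta) * (x * y * ((1 + delta) * L))); last by ring.
rewrite ler_peMl ?lerDl// mulr_ge0// mulr_ge0 ?(ltW L0)//; lra.
Qed.

(** The same inequality with fewer terms, now at the scale [s^alpha = M / eta]
    which suits rows with at most [eta L / M] terms; constants are not optimized. *)
Lemma subrow_sqr_le X (Q : pred 'I_n) Z alpha L M (delta eta : R) (i : 'I_n) :
  2 < alpha -> 0 < L -> 0 < M ->
  delta <= 1 -> 0 < eta -> (forall j, Q j -> X i j) ->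
  \sum_(j | X i j) `|Z i j| `^ alpha <= (1 + delta) * L ->
  #|[set j | Q j]|%:R <= eta * L / M ->
  \sum_(j | Q j) Z i j ^+ 2 <= 2 * eta `^ (1 - 2 / alpha) * scale alpha L M ^+ 2.
Proof.
move=> a2 L0 M0 d1 eta0 QX hS hD.
have a0 : 0 < alpha by lra.
have k0 : 0 < 1 - 2 / alpha by rewrite subr_gt0 ltr_pdivrMr// mul1r.
have t0 : 0 < 2 / alpha by rewrite divr_gt0.
pose s := (M / eta) `^ alpha^-1.
have b0 : 0 < M / eta by rewrite divr_gt0.
have s0 : 0 < s by rewrite powR_gt0.
have sa : s `^ alpha = M / eta.
  by rewrite -powRrM mulVf ?gt_eqF// powRr1 ?ltW.
have s2 : s ^+ 2 = (M / eta) `^ (2 / alpha).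
  by rewrite -powR_mulrn ?ltW// -powRrM [alpha^-1 * _]mulrC.
have s2' : s ^+ 2 * (eta / M) = eta `^ (1 - 2 / alpha) * M `^ (- (1 - 2 / alpha)).
  rewrite s2 !powR_expR// ln_div ?posrE//.
  rewrite -[X in _ * (X / _) = _](@lnK R)// -[X in _ * (_ / X) = _](@lnK R)//.
  by rewrite -expRN -!expRD; congr expR; field; rewrite gt_eqF.
apply: le_trans (sum_sqr_row _ _ a2 s0) _; rewrite sa.
set S := \sum_(j | Q j) _; set D := \sum_(j | Q j) _.
have SS : S <= 2 * L.
  apply: (@le_trans _ _ ((1 + delta) * L)); last by rewrite (ler_wpM2r (ltW L0))//; lra.
  apply: le_trans hS; rewrite /S big_mkcond [leRHS]big_mkcond/=.
  apply: ler_sum => j _; case: (boolP (Q j)) => [/QX -> //|_].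
  by case: ifP => // _; exact: powR_ge0.
have DD : D <= eta * L / M.
  by apply: le_trans hD; rewrite /D sumr_const ler_nat; apply/subset_leq_card/fintype.subsetP => j; rewrite inE.
rewrite scale_sqr//.
apply: (@le_trans _ _ (s ^+ 2 * (2 * (eta * L / M)))); last first.
  rewrite [leLHS](_ : _ = 2 * L * (s ^+ 2 * (eta / M))); last by ring.
  by rewrite s2' le_eqVlt; apply/orP; left; apply/eqP; ring.
rewrite ler_wpM2l ?sqr_ge0//.
have h1 : (1 - 2 / alpha) * D <= (1 - 2 / alpha) * (eta * L / M) by rewrite ler_wpM2l// ltW.
have h2 : 2 / alpha * S / (M / eta) <= 2 / alpha * (2 * L) / (M / eta).
  by rewrite ler_wpM2r ?invr_ge0 ?(ltW b0)// ler_wpM2l// ltW.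
have e2 : 2 / alpha * (2 * L) / (M / eta) = 2 / alpha * 2 * (eta * L / M).
  by field; rewrite !gt_eqF.
have q0 : 0 < eta * L / M by rewrite divr_gt0// mulr_gt0.
have h3 : 2 / alpha * (eta * L / M) <= 1 * (eta * L / M).
  by rewrite (ler_wpM2r (ltW q0))//; lra.
lra.
Qed.

(** Hubs are the vertices of degree at least [eta L / M]; the rest has norm at
    most [kappa] times the scale when [eta] is small. *)
Lemma lambda1_le_scale X Z alpha L M (delta eta kappa : R) (b : nat) :
  (0 < n)%N -> 2 < alpha -> 0 < L -> 0 < M -> 0 <= delta <= 1 -> 0 < eta -> 0 < kappa ->
  (0 < b)%N -> 8 * b%:R * eta `^ (1 - 2 / alpha) <= kappa ^+ 2 ->
  symmetric X -> irreflexive X -> Z^T = Z -> (forall i j, ~~ X i j -> Z i j = 0) ->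
  density_le X b ->
  (forall i, \sum_(j | X i j) `|Z i j| `^ alpha + M * #|nbrs X i|%:R <= (1 + delta) * L) ->
  (forall i, #|[set j | rest X [set i | (eta * L / M <= #|nbrs X i|%:R)%R]%SET i j]|%:R
     <= eta * L / M) ->
  lambda1 Z <= ((1 + delta) * lim_const alpha + kappa) * scale alpha L M.
Proof.
move=> n0 a2 L0 M0 /andP[d0 d1] eta0 k0 b0 hk symX irrX symZ ZX hb hA hR.
set H := [set i | _]%SET in hR.
have sc0 := scale_gt0 alpha L0 M0.
apply/(lambda1_leP _ n0 symZ) => v.
rewrite mulrDl -mulrA.
apply: (@quad_le_star_rest _ _ X H Z v b _
  (2 * eta `^ (1 - 2 / alpha) * scale alpha L M ^+ 2)) => //.
- by rewrite mulr_gt0 ?(mulr_gt0 (lim_const_gt0 a2))//; lra.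
- by rewrite mulr_gt0.
- rewrite [leRHS]exprMn.
  rewrite [leLHS](_ : _ = 8 * b%:R * eta `^ (1 - 2 / alpha) * scale alpha L M ^+ 2); last by ring.
  by rewrite ler_wpM2r ?sqr_ge0.
- by move=> i; apply: row_sqr_le (hA i) => // j; exact: ZX.
- move=> i; apply: (@subrow_sqr_le X (rest X H i) _ _ _ _ delta) => //.
    by move=> j /and3P[].
  apply: le_trans (hA i); rewrite lerDl mulr_ge0// ltW//.
Qed.

End AnalyticBounds.

Section LowerAnalytic.
Context {R : realType} {n : nat}.
Implicit Types (Z : 'M[R]_n) (X : rel 'I_n) (alpha L M : R).

(** A star with [k] leaves of equal weight, of total cost [k t^alpha = (1 - delta)
    (2 / alpha) L], reaches the limit constant up to [1 - delta] once [k] is at least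
    the optimal degree. *)
Lemma star_value_ge alpha L M (delta k : R) :
  2 < alpha -> 0 < L -> 0 < M -> 0 <= delta < 1 -> 0 < k ->
  (1 - 2 / alpha) * L / M <= k ->
  (1 - delta) * (lim_const alpha * scale alpha L M) <=
  Num.sqrt k * ((1 - delta) * (2 / alpha) * L / k) `^ alpha^-1.
Proof.
move=> a2 L0 M0 /andP[d0 d1] k0 hk.
have a0 : 0 < alpha by lra.
have ka0 : 0 < 1 - 2 / alpha by rewrite subr_gt0 ltr_pdivrMr// mul1r.
have th0 : 0 < 2 / alpha by rewrite divr_gt0.
have e0 : 0 < 1 - delta by lra.
have l0 := lim_const_gt0 a2; have s0 := scale_gt0 alpha L0 M0.
have x0 : 0 < (1 - delta) * (2 / alpha) * L / k by rewrite divr_gt0// mulr_gt0// mulr_gt0.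
have lhs0 : 0 <= (1 - delta) * (lim_const alpha * scale alpha L M).
  by rewrite ltW// mulr_gt0// mulr_gt0.
have rhs0 : 0 <= Num.sqrt k * ((1 - delta) * (2 / alpha) * L / k) `^ alpha^-1.
  by rewrite mulr_ge0 ?sqrtr_ge0 ?powR_ge0.
rewrite -ler_sqr ?nnegrE//.
rewrite [leRHS]exprMn sqr_sqrtr ?(ltW k0)//.
rewrite [leLHS](_ : _ = (1 - delta) ^+ 2 *
  (lim_const alpha ^+ 2 * scale alpha L M ^+ 2)); last by ring.
rewrite scale_sqr// lim_const_sqr//.
rewrite -[X in _ <= k * X]powR_mulrn ?powR_ge0// -powRrM [alpha^-1 * _]mulrC.
set ka := 1 - 2 / alpha in hk ka0 *; set th := 2 / alpha in x0 th0 *.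
have kath : ka = 1 - th by [].
clearbody ka th.
have -> : k * ((1 - delta) * th * L / k) `^ th =
    k `^ ka * ((1 - delta) `^ th * th `^ th * L `^ th).
  rewrite !powR_expR// ln_div ?posrE// ?mulr_gt0// !lnM ?posrE// ?mulr_gt0//.
  rewrite -[X in X * _ = _](@lnK R)// -!expRD kath; congr expR; ring.
have hk' : (ka * L / M) `^ ka <= k `^ ka.
  by rewrite ge0_ler_powR ?nnegrE ?(ltW ka0) ?(ltW k0)// divr_ge0 ?mulr_ge0 ?ltW.
have -> : (1 - delta) ^+ 2 * (ka `^ ka * th `^ th * (L * M `^ (- ka))) =
    (ka * L / M) `^ ka * ((1 - delta) ^+ 2 * th `^ th * L `^ th).
  rewrite !powR_expR ?divr_gt0 ?mulr_gt0// ln_div ?posrE ?mulr_gt0// lnM ?posrE//.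
  rewrite -[X in _ * (_ * (X * _)) = _](@lnK R)//.
  rewrite [LHS](_ : _ = (1 - delta) ^+ 2 * (expR (ka * ln ka) * expR (th * ln th) * (expR (ln L) * expR (- ka * ln M)))) //.
  rewrite [RHS](_ : _ = (1 - delta) ^+ 2 * (expR (ka * (ln ka + ln L - ln M)) * expR (th * ln th) * expR (th * ln L))); last by ring.
  by congr (_ * _); rewrite -!expRD kath; congr expR; ring.
apply: ler_pM => //; first exact: powR_ge0.
  by rewrite !mulr_ge0 ?powR_ge0 ?(ltW e0)//.
rewrite !ler_wpM2r ?powR_ge0//.
rewrite -(powR_mulrn 2 (ltW e0)) !powR_expR// ler_expR.
rewrite ler_wnM2r// ?ln_le0//; last by lra.
by rewrite kath in ka0; lra.
Qed.

Lemma lambda1_ge_scale X Z alpha L M (delta : R) (b : nat) (c : 'I_n) (S : {set 'I_n}) :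
  2 < alpha -> 0 < L -> 0 < M -> 0 <= delta < 1 ->
  symmetric X -> irreflexive X -> Z^T = Z -> (forall i j, ~~ X i j -> Z i j = 0) ->
  density_le X b ->
  (forall i, \sum_(j | X i j) `|Z i j| `^ alpha <= 2 * L) ->
  (0 < #|S|)%N -> (1 - 2 / alpha) * L / M <= #|S|%:R -> c \notin S ->
  (forall u, u \in S -> ((1 - delta) * (2 / alpha) * L / #|S|%:R) `^ alpha^-1 <= Z c u) ->
  (1 - delta) * (lim_const alpha * scale alpha L M) - b%:R * (2 * L) `^ alpha^-1 <= lambda1 Z.
Proof.
move=> a2 L0 M0 d01 symX irrX symZ ZX hb hA S0 hS cS ht.
have a0 : 0 < alpha by lra.
have Zcc : Z c c = 0 by apply: ZX; rewrite irrX.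
have kR : 0 < #|S|%:R :> R by rewrite ltr0n.
apply: le_trans (lambda1_ge_star (y := (2 * L) `^ alpha^-1) symZ ZX Zcc hb S0 cS _ _ ht).
- by rewrite lerB// star_value_ge.
- exact: powR_ge0.
- move=> i j _ _; have [XX|/ZX ->] := boolP (X i j); last by rewrite normr0 powR_ge0.
  rewrite leNgt; apply/negP => h; have := hA i; apply/negP; rewrite -ltNge.
  rewrite (bigD1 j)//= ltr_wpDr//; first by apply: sumr_ge0 => l _; exact: powR_ge0.
  have : ((2 * L) `^ alpha^-1) `^ alpha < `|Z i j| `^ alpha.
    by rewrite gt0_ltr_powR ?nnegrE ?powR_ge0.
  by rewrite -powRrM mulVf ?gt_eqF// powRr1// mulr_ge0// ltW.
Qed.
End LowerAnalytic.

(** * Rare events for independent edge marks *)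

Section ProductLaw.
Context {R : realType} {I F : finType} (pi : F -> R).
Hypotheses (pi_ge0 : forall f, 0 <= pi f) (pi_sum1 : \sum_f pi f = 1).

(** The probability of [A] when the coordinates are independent of law [pi]. *)
Definition prodPr (A : {ffun I -> F} -> Prop) : R :=
  \sum_(a : {ffun I -> F} | `[< A a >]) \prod_i pi (a i).

Lemma prodPr_weight_ge0 (a : {ffun I -> F}) : 0 <= \prod_i pi (a i).
Proof. by apply: prodr_ge0 => i _. Qed.

Lemma prodPr_ge0 A : 0 <= prodPr A.
Proof. by apply: sumr_ge0 => a _; exact: prodPr_weight_ge0. Qed.

Lemma prodPr_sub A B : (forall a, A a -> B a) -> prodPr A <= prodPr B.
Proof.
move=> AB; rewrite /prodPr big_mkcond [leRHS]big_mkcond/=.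
apply: ler_sum => a _; case: asboolP => [/AB Ba|_].
  by case: asboolP.
by case: ifP => // _; exact: prodPr_weight_ge0.
Qed.

Lemma prodPr_exists_in (T : finType) (D : {pred T})
    (A : T -> {ffun I -> F} -> Prop) (x : R) :
  (forall t, t \in D -> prodPr (A t) <= x) ->
  prodPr (fun a => exists2 t, t \in D & A t a) <= #|D|%:R * x.
Proof.
move=> hx; rewrite mulr_natl -sumr_const.
apply: (@le_trans _ _ (\sum_(t in D) prodPr (A t))); last by apply: ler_sum => t /hx.
rewrite /prodPr [leLHS]big_mkcond/=.
under [leRHS]eq_bigr do rewrite big_mkcond/=.
rewrite exchange_big/=; apply: ler_sum => a _.
case: asboolP => [[t tD At]|_].
  rewrite (bigD1 t)//= asboolT// lerDl sumr_ge0// => t' _.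
  by case: ifP => // _; exact: prodPr_weight_ge0.
by apply: sumr_ge0 => t _; case: ifP => // _; exact: prodPr_weight_ge0.
Qed.

Lemma prodPr_exists (T : finType) (A : T -> {ffun I -> F} -> Prop) (x : R) :
  (forall t, prodPr (A t) <= x) -> prodPr (fun a => exists t, A t a) <= #|T|%:R * x.
Proof.
move=> hx; apply: le_trans (prodPr_exists_in (D := predT) (fun t _ => hx t)).
by apply: prodPr_sub => a [t At]; exists t.
Qed.

Lemma prodPr_and (Q : Prop) (A : {ffun I -> F} -> Prop) (x : R) :
  0 <= x -> (Q -> prodPr A <= x) -> prodPr (fun a => Q /\ A a) <= x.
Proof.
move=> x0 h; have [q|nq] := pselect Q.
  by apply: le_trans (h q); apply: prodPr_sub => a [].
by rewrite /prodPr big_pred0// => a; apply/asboolP => -[].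
Qed.

Lemma prodPr_or A B : prodPr (fun a => A a \/ B a) <= prodPr A + prodPr B.
Proof.
rewrite /prodPr [leLHS]big_mkcond/= [X in _ <= X + _]big_mkcond [X in _ <= _ + X]big_mkcond/=.
rewrite -big_split/=; apply: ler_sum => a _; have := prodPr_weight_ge0 a.
case: asboolP => [[|]h|]; do 2 case: asboolP => //; lra.
Qed.

Lemma prodPr_markov (A : {ffun I -> F} -> Prop) (g : I -> F -> R) (c : R) :
  (forall i f, 0 <= g i f) -> (forall a, A a -> c <= \prod_i g i (a i)) ->
  c * prodPr A <= \prod_i \sum_f pi f * g i f.
Proof.
move=> g0 hA; rewrite bigA_distr_bigA/= /prodPr mulr_sumr big_mkcond/=.
apply: ler_sum => a _; rewrite big_split/= mulrC.
case: asboolP => [/hA h|_]; first by rewrite ler_wpM2l// prodPr_weight_ge0.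
by rewrite mulr_ge0 ?prodPr_weight_ge0// prodr_ge0.
Qed.

End ProductLaw.

Lemma sum_option (R : realType) (F : finType) (g : option F -> R) :
  \sum_f g f = g None + \sum_f g (Some f).
Proof.
rewrite (bigD1 None)//=; congr (_ + _).
by rewrite (reindex_omap Some id)/=; [apply: eq_bigl => f; rewrite eqxx|case].
Qed.

(** Exponential Markov inequality for a weighted sum of independent marks, an
    unmarked item contributing nothing, jointly with the requirement that the
    items of [J] are marked. *)
Lemma prodPr_chernoff (R : realType) (I F : finType) (pi : option F -> R)
    (J : {set I}) (w : I -> nat) (W : nat) (u : option F -> R) (s B : R) :
  (forall f, 0 <= pi f) -> \sum_f pi f = 1 ->
  u None = 0 -> (forall f, 0 <= u f) -> (forall i, (w i <= W)%N) ->
  B = \sum_f pi (Some f) * expR (W%:R * u (Some f)) ->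
  prodPr pi (fun a : {ffun I -> option F} =>
    (forall i, i \in J -> a i != None) /\ s <= \sum_i (w i)%:R * u (a i)) <=
  B ^+ #|J| * expR (B * (\sum_i w i)%:R - s).
Proof.
move=> pi0 pi1 uN u0 wW BE.
have B0 : 0 <= B by rewrite BE; apply: sumr_ge0 => f _; rewrite mulr_ge0// expR_ge0.
pose g i f := (if i \in J then (f != None)%:R else 1) * expR ((w i)%:R * u f).
have g0 i f : 0 <= g i f by rewrite mulr_ge0 ?expR_ge0//; case: ifP.
rewrite expRD expRN mulrA ler_pdivlMr ?expR_gt0// mulrC.
apply: le_trans (prodPr_markov pi0 (g := g) _ _) _ => // [a [aJ hs]|].
  rewrite /g big_split/= -expR_sum big1 ?mul1r ?ler_expR// => i _.
  by case: ifP => // /aJ ->.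
have -> : B ^+ #|J| * expR (B * (\sum_i w i)%:R) =
    \prod_i ((if i \in J then B else 1) * expR (B * (w i)%:R)).
  rewrite big_split/= -expR_sum -mulr_sumr -natr_sum; congr (_ * _).
  by rewrite -big_mkcond/= prodr_const.
apply: ler_prod => i _; rewrite sumr_ge0/=; last by move=> f _; rewrite mulr_ge0.
have hB (f : F) : pi (Some f) * expR ((w i)%:R * u (Some f)) <=
    pi (Some f) * expR (W%:R * u (Some f)).
  by rewrite ler_wpM2l// ler_expR ler_wpM2r// ler_nat.
rewrite sum_option /g; case: ifP => _ /=.
  rewrite mul0r mulr0 add0r; under eq_bigr do rewrite mul1r.
  rewrite -[leLHS]mulr1; apply: ler_pM => //.
  - by apply: sumr_ge0 => f _; rewrite mulr_ge0// expR_ge0.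
  - by rewrite BE; apply: ler_sum => f _.
  - by rewrite -expR0 ler_expR mulr_ge0.
rewrite !mul1r uN mulr0 expR0 mulr1; under eq_bigr do rewrite mul1r.
apply: le_trans (expR_ge1Dx _).
have -> : pi None = 1 - \sum_f pi (Some f) by rewrite -pi1 sum_option; ring.
rewrite -addrA lerD2l addrC -sumrB BE mulrC mulr_sumr.
apply: ler_sum => f _; case: (w i) (hB f) => [|m] h.
  by rewrite mul0r expR0 mulr1 subrr mul0r.
rewrite lerBlDr; apply: le_trans h _; apply: ler_wpDr; first exact: pi0.
by rewrite ler_peMl ?ler1n// mulr_ge0// expR_ge0.
Qed.

Section MarkedGraph.
Context {n : nat} {F : finType}.
Implicit Types (a : {ffun upper_pair n -> option F}) (i j : 'I_n).

(** An edge is stored as an increasing pair; [edge_of] and [mark] make it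
    accessible from both ends. *)
Definition edge_of i j : option (upper_pair n) :=
  if insub (i, j) is Some e then Some e else insub (j, i).

Definition mark a i j : option F := obind a (edge_of i j).

Definition mgraph a : rel 'I_n := fun i j => mark a i j != None.

Lemma edge_of_lt i j (ij : (i < j)%N) :
  edge_of i j = Some (exist (fun p : 'I_n * 'I_n => (p.1 < p.2)%N) (i, j) ij).
Proof.
rewrite /edge_of; case: insubP => [e _ ev|]; last by rewrite /= ij.
by congr Some; apply: val_inj.
Qed.

Lemma edge_ofC i j : edge_of i j = edge_of j i.
Proof.
rewrite /edge_of; case: insubP => [e eP ev|nij]; case: insubP => [e' eP' ev'|nji] //.
by move: eP eP'; rewrite /= => ij ji; have := ltn_trans ij ji; rewrite ltnn.
Qed.

Lemma edge_of_val (e : upper_pair n) : edge_of (val e).1 (val e).2 = Some e.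
Proof.
rewrite (edge_of_lt (valP e)); congr Some; apply: val_inj => /=.
by case: (val e).
Qed.

Lemma edge_ofP i j e : edge_of i j = Some e ->
  val e = (i, j) \/ val e = (j, i).
Proof.
rewrite /edge_of; case: insubP => [e' _ ev [<-]|_]; first by left.
by case: insubP => // e' _ ev [<-]; right.
Qed.

Lemma edge_of_neq i j : i != j -> exists e, edge_of i j = Some e.
Proof.
rewrite -(inj_eq val_inj) neq_ltn => /orP[] h; last rewrite edge_ofC.
  by eexists; exact: edge_of_lt h.
by eexists; exact: edge_of_lt h.
Qed.

Lemma markC a i j : mark a i j = mark a j i.
Proof. by rewrite /mark edge_ofC. Qed.

Lemma mark_diag a i : mark a i i = None.
Proof.
rewrite /mark; case E: (edge_of i i) => [e|//].
by have := valP e; have [->|->] := edge_ofP E; rewrite /= ltnn.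
Qed.

Lemma mark_val a (e : upper_pair n) : mark a (val e).1 (val e).2 = a e.
Proof. by rewrite /mark edge_of_val. Qed.

Lemma mgraph_irr a : irreflexive (mgraph a).
Proof. by move=> i; rewrite /mgraph mark_diag. Qed.

(** Every sum over rows reduces to a sum over edges, that is over independent
    coordinates, through this double counting. *)
Lemma sum_upper_pair (V : nmodType) (f : 'I_n -> 'I_n -> V) :
  \sum_(e : upper_pair n) (f (val e).1 (val e).2 + f (val e).2 (val e).1) =
  \sum_i \sum_(j | j != i) f i j.
Proof.
have sumE (g : 'I_n * 'I_n -> V) :
    \sum_(e : upper_pair n) g (val e) = \sum_(p : 'I_n * 'I_n | (p.1 < p.2)%N) g p.
  rewrite [RHS](reindex_omap (fun e : upper_pair n => val e) insub)/=; last first.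
    by move=> p hp; rewrite insubT.
  by apply: eq_bigl => e; rewrite (valP e) valK eqxx.
rewrite (sumE (fun p => f p.1 p.2 + f p.2 p.1)) big_split/=.
rewrite [X in _ + X](reindex_inj (h := fun p => (p.2, p.1)))/=; last first.
  by move=> [x y] [x' y'] /= [-> ->].
rewrite pair_big_dep/= [RHS](bigID (fun p : 'I_n * 'I_n => (p.1 < p.2)%N))/=.
congr (_ + _); apply: eq_bigl => -[i j] /=; rewrite -(inj_eq val_inj) neq_ltn.
  by case: ltngtP.
by rewrite -leqNgt; case: ltngtP.
Qed.

Lemma edge_family (K : finType) (x y : K -> 'I_n) :
  (forall k, x k != y k) ->
  (forall k l, edge_of (x k) (y k) = edge_of (x l) (y l) -> k = l) ->
  exists2 J : {set upper_pair n}, #|J| = #|K| &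
    forall a, (forall k, mgraph a (x k) (y k)) -> forall e, e \in J -> a e != None.
Proof.
move=> xy inj.
have /fin_all_exists[e he] k := edge_of_neq (xy k).
exists (e @: K); first by rewrite card_imset// => k l kl; apply: inj; rewrite !he kl.
by move=> a aK _ /imsetP[k _ ->]; have := aK k; rewrite /mgraph /mark he.
Qed.

End MarkedGraph.

Section MarkedGraphBounds.
Context {R : realType} {n : nat} {F : finType} (pi : option F -> R).
Hypotheses (pi_ge0 : forall f, 0 <= pi f) (pi_sum1 : \sum_f pi f = 1).
Implicit Types (a : {ffun upper_pair n -> option F}).

Lemma sum_rows_upper_pair a (u : option F -> R) (S : {set 'I_n}) :
  u None = 0 ->
  \sum_(e : upper_pair n) (((val e).1 \in S) + ((val e).2 \in S))%N%:R * u (a e) =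
  \sum_(i in S) \sum_j u (mark a i j).
Proof.
move=> uN; under eq_bigr do rewrite natrD mulrDl -mark_val.
under eq_bigr do rewrite [X in _ + _ * u X]markC.
rewrite (sum_upper_pair (fun i j => (i \in S)%:R * u (mark a i j))).
rewrite [RHS]big_mkcond/=; apply: eq_bigr => i _.
rewrite -mulr_sumr [in RHS](bigD1 i)//= mark_diag uN add0r.
by case: (i \in S); rewrite ?mul1r ?mul0r.
Qed.

(** Joint Chernoff bound for the total cost of the rows in [S] and the presence
    of prescribed edges.  The weight of an edge is its number of ends in [S], so
    [W] is [2] in general and [1] for a single row, where sharpness matters. *)
Lemma prodPr_rows (K : finType) (x y : K -> 'I_n) (S : {set 'I_n}) (W : nat)
    (u : option F -> R) (s B : R) :
  (forall k, x k != y k) ->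
  (forall k l, edge_of (x k) (y k) = edge_of (x l) (y l) -> k = l) ->
  (forall i j, i != j -> ((i \in S) + (j \in S) <= W)%N) ->
  u None = 0 -> (forall f, 0 <= u f) ->
  B = \sum_f pi (Some f) * expR (W%:R * u (Some f)) ->
  prodPr pi (fun a => (forall k, mgraph a (x k) (y k)) /\
      s <= \sum_(i in S) \sum_j u (mark a i j)) <=
    B ^+ #|K| * expR (B * (#|S| * n)%:R - s).
Proof.
move=> xy inj hW uN u0 BE.
have B0 : 0 <= B by rewrite BE; apply: sumr_ge0 => f _; rewrite mulr_ge0// expR_ge0.
have [J JK hJ] := edge_family (F := F) xy inj.
pose w (e : upper_pair n) := (((val e).1 \in S) + ((val e).2 \in S))%N.
have wW e : (w e <= W)%N.
  by apply: hW; apply/eqP => h; have := valP e; rewrite /= h ltnn.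
apply: le_trans (le_trans (prodPr_sub pi_ge0 _) (prodPr_chernoff J s pi_ge0 pi_sum1 uN u0 wW BE)) _.
  by move=> a [/hJ aJ]; rewrite -sum_rows_upper_pair.
rewrite JK ler_wpM2l ?exprn_ge0// ler_expR lerD2r ler_wpM2l// ler_nat.
rewrite /w (sum_upper_pair (fun i _ => (i \in S) : nat)) -sum1_card big_distrl/=.
rewrite [leqRHS]big_mkcond/=; apply: leq_sum => i _.
rewrite sum_nat_const; case: (i \in S); rewrite ?muln0// muln1 mul1n.
by rewrite -[leqRHS]card_ord max_card.
Qed.

(** The factor [1 / 2] in the exponent comes from the double sum, which counts
    the edges inside [S] twice. *)
Lemma prodPr_dense (S : {set 'I_n}) (theta s B : R) : 0 <= theta ->
  B = (\sum_f pi (Some f)) * expR theta ->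
  prodPr pi (fun a => s <= (\sum_(i in S) #|nbrs (mgraph a) i :&: S|)%:R) <=
    expR (B * (#|S| * #|S|)%:R - theta * s / 2).
Proof.
move=> t0 BE.
have B0 : 0 <= B by rewrite BE mulr_ge0 ?expR_ge0// sumr_ge0.
pose u (f : option F) : R := if f is Some _ then theta else 0.
have u0 f : 0 <= u f by case: f.
pose w (e : upper_pair n) := (((val e).1 \in S) && ((val e).2 \in S) : nat).
have wW e : (w e <= 1)%N by rewrite /w leq_b1.
have BE' : B = \sum_f pi (Some f) * expR (1%:R * u (Some f)).
  by rewrite BE mulr_suml; apply: eq_bigr => f _; rewrite mul1r.
apply: le_trans (le_trans (prodPr_sub pi_ge0 _)
  (prodPr_chernoff finset.set0 (theta * s / 2) pi_ge0 pi_sum1 (erefl _) u0 wW BE')) _.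
  move=> a hs; split=> [e|]; first by rewrite finset.in_set0.
  rewrite ler_pdivrMr// mulr_natr mulr2n -big_split/=.
  have -> : \sum_(e : upper_pair n) ((w e)%:R * u (a e) + (w e)%:R * u (a e)) =
      theta * (\sum_(i in S) #|nbrs (mgraph a) i :&: S|)%:R.
    pose f i j : R := (((i \in S) && (j \in S)) : nat)%:R * u (mark a i j).
    rewrite (eq_bigr (fun e : upper_pair n =>
      f (val e).1 (val e).2 + f (val e).2 (val e).1)); last first.
      move=> e _; rewrite /f [mark a (val e).2 _]markC mark_val /w.
      by rewrite [((val e).2 \in S) && _]andbC.
    rewrite (sum_upper_pair f) /f.
    rewrite natr_sum mulr_sumr [RHS]big_mkcond/=; apply: eq_bigr => i _.
    case: (boolP (i \in S)) => iS /=; last by rewrite big1// => j _; rewrite mul0r.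
    rewrite -sum1_card natr_sum mulr_sumr big_mkcond [RHS]big_mkcond/=.
    apply: eq_bigr => j _; rewrite !inE /mgraph.
    have [->|ji] := eqVneq j i; first by rewrite mark_diag.
    case: (mark a i j) => [m|] /=; rewrite ?mulr0//.
    by case: (j \in S); rewrite ?mul1r ?mulr1 ?mul0r.
  by rewrite ler_wpM2l.
rewrite cards0 expr0 mul1r ler_expR lerD2r ler_wpM2l// ler_nat.
rewrite -[leqRHS]sum_nat_const.
apply: (@leq_trans (\sum_(e : upper_pair n) (w e + w e))).
  by apply: leq_sum => e _; rewrite leq_addr.
rewrite (eq_bigr (fun e : upper_pair n => w e + ((val e).2 \in S) && ((val e).1 \in S))%N); last first.
  by move=> e _; rewrite /w andbC.
rewrite (sum_upper_pair (fun i j => ((i \in S) && (j \in S)) : nat)).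
rewrite [leqRHS]big_mkcond/=; apply: leq_sum => i _.
case: (i \in S) => /=; last by rewrite big1.
by rewrite -sum1_card big_mkcond [leqRHS]big_mkcond; apply: leq_sum => j _; case: eqVneq => _ /=; case: (j \in S).
Qed.

End MarkedGraphBounds.

Lemma edge_of_inj (n : nat) (i j i' j' : 'I_n) : i != j ->
  edge_of i j = edge_of i' j' -> (i = i' /\ j = j') \/ (i = j' /\ j = i').
Proof.
move=> /edge_of_neq[e he]; rewrite he => /esym he'.
by have [E|E] := edge_ofP he; have [E'|E'] := edge_ofP he';
  move: E'; rewrite E => -[-> ->]; [left|right|right|left].
Qed.

Section RareEvents.
Context {R : realType} {n : nat} {F : finType} (pi : option F -> R).
Hypotheses (pi_ge0 : forall f, 0 <= pi f) (pi_sum1 : \sum_f pi f = 1).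
Implicit Types (a : {ffun upper_pair n -> option F}).

Definition hubs a (K : R) : {set 'I_n} := [set i | K <= #|nbrs (mgraph a) i|%:R].

(** A union bound over the [n] rows. *)
Lemma prodPr_row (u : option F -> R) (s : R) :
  u None = 0 -> (forall f, 0 <= u f) ->
  prodPr pi (fun a => exists i, s <= \sum_j u (mark a i j)) <=
  n%:R * expR ((\sum_f pi (Some f) * expR (u (Some f))) * n%:R - s).
Proof.
move=> uN u0; rewrite -[X in X%:R * _]card_ord; apply: prodPr_exists => // i.
have := prodPr_rows (K := void) (x := of_void _) (y := of_void _) (S := [set i]%SET)
  (W := 1) pi_ge0 pi_sum1 s _ _ _ uN u0 (erefl _).
rewrite card_void expr0 mul1r cards1 mul1n; under eq_bigr do rewrite mul1r.
move=> h; apply: le_trans (h _ _ _) => //.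
  apply: prodPr_sub => // a hs; split=> [[]|]//; by rewrite big_set1.
move=> j k jk; rewrite !inE; move: jk; case: (eqVneq j i) => [->|_ _] /=; last by case: (k == i).
by rewrite eq_sym => /negbTE ->.
Qed.

Lemma prodPr_hubs (L : finType) (x y : L -> 'I_n) (r : nat)
    (f : {ffun 'I_r -> 'I_n}) (theta K : R) : 0 <= theta ->
  (forall k, x k != y k) ->
  (forall k l, edge_of (x k) (y k) = edge_of (x l) (y l) -> k = l) ->
  injective f ->
  forall B, B = (\sum_f pi (Some f)) * expR (2 * theta) ->
  prodPr pi (fun a => (forall k, mgraph a (x k) (y k)) /\ forall k, f k \in hubs a K) <=
    B ^+ #|L| * expR (B * (r * n)%:R - theta * K * r%:R).
Proof.
move=> t0 xy inj finj B BE.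
pose u (m : option F) : R := if m is Some _ then theta else 0.
have u0 m : 0 <= u m by case: m.
have cardS : #|(f @: [set: 'I_r])%SET| = r by rewrite card_imset// cardsT card_ord.
have BE' : B = \sum_f pi (Some f) * expR (2%:R * u (Some f)).
  by rewrite BE mulr_suml.
have := prodPr_rows (S := (f @: [set: 'I_r])%SET) (W := 2) pi_ge0 pi_sum1
  (theta * K * r%:R) xy inj _ (erefl _ : u None = 0) u0 BE'.
rewrite cardS => h; apply: le_trans (h _); last first.
  by move=> i j _; case: (_ \in _); case: (_ \in _).
apply: prodPr_sub => // a [hxy hf]; split=> //.
rewrite (big_imset _ (in2W finj))/=.
under eq_bigl do rewrite finset.in_setT.
rewrite mulrC -[X in X%:R * _]card_ord mulr_natl -sumr_const; apply: ler_sum => k _.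
have := hf k; rewrite inE => /(ler_wpM2l t0)/le_trans; apply.
rewrite -sum1_card natr_sum mulr_sumr big_mkcond/=; apply: ler_sum => j _.
by rewrite !inE /mgraph; case: (mark a (f k) j) => //= m; rewrite mulr1.
Qed.

(** A star has [r + 1] vertices and [r] edges, so that its number of positions
    exceeds the cost of its edges by a single factor [n], whereas each of its [r]
    hubs costs an exponential factor. *)
Lemma prodPr_hub_star (r : nat) (theta K : R) : 0 <= theta ->
  forall B, B = (\sum_f pi (Some f)) * expR (2 * theta) ->
  prodPr pi (fun a => exists h f, @hub_star n (mgraph a) (hubs a K) r h f) <=
    n%:R * (n%:R * B * expR (B * n%:R - theta * K)) ^+ r.
Proof.
move=> t0 B BE.
have B0 : 0 <= B by rewrite BE mulr_ge0 ?expR_ge0// sumr_ge0.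
have X0 : 0 <= (B * expR (B * n%:R - theta * K)) ^+ r.
  by rewrite exprn_ge0// mulr_ge0// expR_ge0.
rewrite -mulrA exprMn mulrA -natrX -natrM.
have -> : (n * n ^ r)%N = #|{: 'I_n * {ffun 'I_r -> 'I_n}}|.
  by rewrite card_prod card_ffun !card_ord.
apply: (le_trans _ (prodPr_exists pi_ge0 (A := fun (t : 'I_n * {ffun 'I_r -> 'I_n}) a =>
    (injective t.2 /\ (forall k, t.1 != t.2 k)) /\ (forall k, mgraph a t.1 (t.2 k)) /\
    forall k, t.2 k \in hubs a K) _)).
  apply: prodPr_sub => // a [h [f [finj hf fH]]]; exists (h, f) => /=.
  split=> //; split=> // k; apply: contraTneq (hf k) => <-.
  by rewrite mgraph_irr.
move=> [h f]; apply: prodPr_and => // -[/= finj hf].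
apply: le_trans (prodPr_hubs (x := fun=> h) (y := f) K t0 _ _ finj BE) _ => //.
  move=> k l; move=> /(edge_of_inj (hf k)) [[_ /finj]//|[hl]].
  by have := hf l; rewrite {1}hl eqxx.
rewrite card_ord exprMn -expRM_natl; apply: ler_wpM2l; first exact: exprn_ge0.
by rewrite ler_expR natrM le_eqVlt; apply/orP; left; apply/eqP; rewrite -mulr_natl; ring.
Qed.

(** As for stars: [2 r + 1] vertices, [2 r] edges and [r] hubs. *)
Lemma prodPr_hub_spider (r : nat) (theta K : R) : 0 <= theta ->
  forall B, B = (\sum_f pi (Some f)) * expR (2 * theta) ->
  prodPr pi (fun a => exists h u w, @hub_spider n (mgraph a) (hubs a K) r h u w) <=
    n%:R * ((n%:R * B) ^+ 2 * expR (B * n%:R - theta * K)) ^+ r.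
Proof.
move=> t0 B BE.
have B0 : 0 <= B by rewrite BE mulr_ge0 ?expR_ge0// sumr_ge0.
have X0 : 0 <= (B ^+ 2 * expR (B * n%:R - theta * K)) ^+ r.
  by rewrite exprn_ge0// mulr_ge0 ?exprn_ge0// expR_ge0.
have -> : n%:R * ((n%:R * B) ^+ 2 * expR (B * n%:R - theta * K)) ^+ r =
    (n * n ^ (2 * r))%:R * (B ^+ 2 * expR (B * n%:R - theta * K)) ^+ r.
  by rewrite natrM natrX exprM !exprMn; ring.
have -> : (n * n ^ (2 * r))%N =
    #|{: 'I_n * {ffun 'I_r -> 'I_n} * {ffun 'I_r -> 'I_n}}|.
  by rewrite !card_prod card_ffun !card_ord mul2n -addnn expnD mulnA.
apply: (le_trans _ (prodPr_exists pi_ge0 (A := fun (t : 'I_n * {ffun 'I_r -> 'I_n} * {ffun 'I_r -> 'I_n}) a =>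
    ([/\ injective t.1.2, injective t.2, forall k l, t.1.2 k != t.2 l,
       forall k, t.1.1 != t.1.2 k & forall k, t.1.1 != t.2 k]) /\
    (forall k : 'I_r + 'I_r, mgraph a (if k is inr k then t.1.2 k else t.1.1)
      (match k with inl k => t.1.2 k | inr k => t.2 k end)) /\
    forall k, t.2 k \in hubs a K) _)).
  apply: prodPr_sub => // a [h [u [w [huw hu uw wH]]]]; exists (h, u, w) => /=.
  by split=> //; split=> // -[k|k].
move=> [[h u] w]; apply: prodPr_and => // -[/= uinj winj uw hu hw].
apply: le_trans (prodPr_hubs K t0 _ _ winj BE) _ => //.
- by move=> [k|k].
- move=> [k|k] [l|l].
  + move=> /(edge_of_inj (hu k)) [[_ /uinj ->]//|[hl]].
    by have := hu l; rewrite {1}hl eqxx.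
  + move=> /(edge_of_inj (hu k)) [[hl]|[hl]].
      by have := hu l; rewrite {1}hl eqxx.
    by have := hw l; rewrite {1}hl eqxx.
  + move=> /(edge_of_inj (uw k k)) [[hl _]|[_ hl]].
      by have := hu k; rewrite hl eqxx.
    by have := hw k; rewrite hl eqxx.
  + move=> /(edge_of_inj (uw k k)) [[/uinj ->]//|[hl]].
    by have := uw k l; rewrite hl eqxx.
rewrite card_sum card_ord exprMn -expRM_natl -exprM mul2n addnn.
apply: ler_wpM2l; first exact: exprn_ge0.
by rewrite ler_expR natrM le_eqVlt; apply/orP; left; apply/eqP; rewrite -mulr_natl; ring.
Qed.

(** Two vertices with three common neighbours form a graph with five vertices and
    six edges. *)
Lemma prodPr_codegree :
  prodPr pi (fun a => ~ codegree_le2 (mgraph a)) <=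
    n%:R ^+ 5 * (\sum_f pi (Some f)) ^+ 6.
Proof.
have q0 : 0 <= \sum_f pi (Some f) by rewrite sumr_ge0.
have -> : n%:R ^+ 5 = #|{: 'I_n * 'I_n * {ffun 'I_3 -> 'I_n}}|%:R :> R.
  by rewrite !card_prod card_ffun !card_ord -natrX; congr (_%:R); rewrite !expnS expn0 !muln1 !mulnA.
apply: (le_trans _ (prodPr_exists pi_ge0 (A := fun (t : 'I_n * 'I_n * {ffun 'I_3 -> 'I_n}) a =>
    [/\ t.1.1 != t.1.2, injective t.2, forall k, t.1.1 != t.2 k &
      forall k, t.1.2 != t.2 k] /\
    (forall k : 'I_3 + 'I_3, mgraph a (if k is inl k then t.1.1 else t.1.2)
      (match k with inl k => t.2 k | inr k => t.2 k end)) /\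
    forall k : 'I_0, [ffun=> t.1.1] k \in hubs a 0) _)).
  apply: prodPr_sub => // a /existsNP[x] /existsNP[y] /not_implyP[xy] /negP.
  rewrite -ltnNge => /inj_ffun_in[f finj hf]; exists (x, y, f) => /=.
  have hx k : mgraph a x (f k) by have := hf k; rewrite !inE => /andP[].
  have hy k : mgraph a y (f k) by have := hf k; rewrite !inE => /andP[].
  split; first split=> // k.
  + by apply: contraTneq (hx k) => <-; rewrite mgraph_irr.
  + by apply: contraTneq (hy k) => <-; rewrite mgraph_irr.
  + by split=> [[k|k]|[]].
move=> [[x y] f]; apply: (prodPr_and _ (exprn_ge0 _ q0)) => // -[/= xy finj xf yf].
apply: le_trans (prodPr_hubs 0 (lexx 0) _ _ _ (erefl _)) _ => //.
- by move=> [k|k].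
- move=> [k|k] [l|l] /=.
  + move=> /(edge_of_inj (xf k)) [[_ /finj ->]//|[hl]].
    by have := xf l; rewrite {1}hl eqxx.
  + move=> /(edge_of_inj (xf k)) [[hl]|[hl]].
      by move: xy; rewrite hl eqxx.
    by have := xf l; rewrite {1}hl eqxx.
  + move=> /(edge_of_inj (yf k)) [[hl]|[hl]].
      by move: xy; rewrite hl eqxx.
    by have := yf l; rewrite {1}hl eqxx.
  + move=> /(edge_of_inj (yf k)) [[_ /finj ->]//|[hl]].
    by have := yf l; rewrite {1}hl eqxx.
- by move=> [].
by rewrite card_sum card_ord !(mulr0, mul0r, mul0n, expR0, mulr1, subr0).
Qed.

End RareEvents.

(** Keep the term of order [k] in [(1 + k / n) ^+ n <= expR k]. *)
Lemma bin_le_expR (R : realType) (n k : nat) : (0 < k)%N -> (0 < n)%N ->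
  'C(n, k)%:R <= expR (k%:R * (1 + ln (n%:R / k%:R))) :> R.
Proof.
move=> k0 n0; have kR : 0 < k%:R :> R by rewrite ltr0n.
have nR : 0 < n%:R :> R by rewrite ltr0n.
have [kn|nk] := leqP k n; last by rewrite bin_small// expR_ge0.
have x0 : 0 < k%:R / n%:R :> R by rewrite divr_gt0.
have h1 : 'C(n, k)%:R * (k%:R / n%:R) ^+ k <= (1 + k%:R / n%:R) ^+ n :> R.
  rewrite exprDn (bigD1 (Ordinal (kn : k < n.+1)%N))//=.
  rewrite expr1n mul1r mulr_natl lerDl; apply: sumr_ge0 => i _.
  by rewrite expr1n mul1r mulrn_wge0// exprn_ge0// ltW.
have h2 : (1 + k%:R / n%:R) ^+ n <= expR k%:R :> R.
  rewrite -[X in expR X](@divfK _ n%:R)// ?gt_eqF// [X in expR X]mulrC expRM_natl.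
  by rewrite lerXn2r ?nnegrE ?expR_ge0 ?expR_ge1Dx// addr_ge0// ltW.
rewrite mulrDr mulr1 expRD expRM_natl lnK ?posrE ?divr_gt0//.
rewrite -ler_pdivrMr ?exprn_gt0 ?divr_gt0// -exprVn invf_div.
exact: le_trans h1 h2.
Qed.

Section NotDense.
Context {R : realType} {n : nat} {F : finType} (pi : option F -> R).
Hypotheses (pi_ge0 : forall f, 0 <= pi f) (pi_sum1 : \sum_f pi f = 1).
Implicit Types (a : {ffun upper_pair n -> option F}).

(** The choice [expR theta = e * n / k], for sets of [k] vertices, balances the
    entropy [ln 'C(n, k)] against the tail of the number of edges; the
    condition on [b] leaves a bound [expR (- (2 * k * theta))], at most [n^-2]. *)
Lemma prodPr_not_dense (b : nat) (d : R) : (0 < n)%N -> 0 <= d ->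
  (\sum_f pi (Some f)) * n%:R = d ->
  6 + 2 * (d * expR 1) <= b%:R ->
  prodPr pi (fun a => ~ density_le (mgraph a) b) <= n.+1%:R * n%:R ^- 2.
Proof.
move=> n0 d0 qn hb; have nR : 0 < n%:R :> R by rewrite ltr0n.
have nV0 : 0 <= n%:R ^- 2 :> R by rewrite invr_ge0 exprn_ge0// ltW.
rewrite -[X in X%:R * _]card_ord.
apply: (le_trans _ (prodPr_exists pi_ge0 (A := fun (k : 'I_n.+1) (a : {ffun upper_pair n -> option F}) => (0 < k)%N /\
    exists2 S : {set 'I_n}, S \in [pred S : {set 'I_n} | #|S| == k] &
      (b * #|S|)%:R <= (\sum_(i in S) #|nbrs (mgraph a) i :&: S|)%:R :> R) _)).
  apply: prodPr_sub => // a /existsNP[S /negP]; rewrite -ltnNge => hS.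
  have Sn : (#|S| < n.+1)%N by rewrite ltnS -[leqRHS]card_ord max_card.
  exists (Ordinal Sn); split; last by exists S; rewrite ?inE//= ler_nat ltnW.
  rewrite /= lt0n; apply: contraTneq hS => /cards0_eq ->.
  by rewrite big_set0.
move=> [k /= kn]; apply: prodPr_and => // k0.
have kR : 0 < k%:R :> R by rewrite ltr0n.
have k1 : 1 <= k%:R :> R by rewrite ler1n.
have knR : k%:R <= n%:R :> R by rewrite ler_nat.
pose theta : R := 1 + ln (n%:R / k%:R).
have lnkn : ln k%:R <= ln n%:R :> R by rewrite ler_ln// posrE.
have thetaE : theta = 1 + ln n%:R - ln k%:R by rewrite /theta ln_div ?posrE// addrA.
have theta1 : 1 <= theta by rewrite thetaE; lra.
have kt : ln n%:R <= k%:R * theta.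
  have : ln k%:R <= k%:R - 1 :> R.
    by have := expR_ge1Dx (ln k%:R : R); rewrite lnK ?posrE//; lra.
  have : (k%:R - 1) * ln k%:R <= (k%:R - 1) * ln n%:R :> R by rewrite ler_wpM2l// subr_ge0.
  rewrite thetaE; lra.
have hS (S : {set 'I_n}) : S \in [pred S : {set 'I_n} | #|S| == k] ->
    prodPr pi (fun a => (b * #|S|)%:R <= (\sum_(i in S) #|nbrs (mgraph a) i :&: S|)%:R :> R) <=
    expR (- (3 * k%:R * theta)).
  rewrite inE => /eqP Sk.
  apply: le_trans (prodPr_dense pi_ge0 pi_sum1 _ _ (theta := theta) _ (erefl _)) _; first by lra.
  rewrite ler_expR Sk.
  have -> : (\sum_f pi (Some f)) * expR theta * (k * k)%:R = d * expR 1 * k%:R.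
    rewrite /theta expRD lnK ?posrE ?divr_gt0// natrM -qn; field; exact: lt0r_neq0.
  rewrite natrM; set c := d * expR 1 in hb *.
  have c0 : 0 <= c by rewrite mulr_ge0// expR_ge0.
  have : k%:R * theta * (6 + 2 * c) <= k%:R * theta * b%:R.
    by rewrite ler_wpM2l// mulr_ge0 ?ltW//; lra.
  have : k%:R * c * 1 <= k%:R * c * theta by rewrite ler_wpM2l// mulr_ge0// ltW.
  lra.
apply: le_trans (prodPr_exists_in pi_ge0 hS) _.
rewrite (_ : #|_| = 'C(n, k)); last first.
  by rewrite -[in RHS](card_ord n) -card_draws; apply: eq_card => S; rewrite !inE.
apply: (@le_trans _ _ (expR (k%:R * theta) * expR (- (3 * k%:R * theta)))).
  by rewrite ler_wpM2r ?expR_ge0// bin_le_expR.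
rewrite -expRD -[n%:R in leRHS](@lnK R) ?posrE// -expRM_natl -expRN ler_expR; lra.
Qed.
End NotDense.

Lemma geometric_sum_le (R : realFieldType) (q : R) (N : nat) : 0 <= q < 1 ->
  \sum_(i < N) q ^+ i <= (1 - q)^-1.
Proof.
move=> /andP[q0 q1]; rewrite -[leRHS]mul1r ler_pdivlMr ?subr_gt0//.
rewrite mulrC -opprB mulNr -subrX1 opprB lerBlDr lerDl exprn_ge0//.
Qed.

Section EventProbabilities.
Context {R : realType} {n N : nat} (pi : option 'I_N -> R).
Hypotheses (pi_ge0 : forall f, 0 <= pi f) (pi_sum1 : \sum_f pi f = 1).
Implicit Types (a : {ffun upper_pair n -> option 'I_N}).
Variables (d : R) (L M : R).
Hypotheses (d0 : 0 < d) (n0 : (0 < n)%N) (nL : n%:R = expR L) (LM : L = expR M)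
  (M0 : 0 < M).
Let p : R := \sum_f pi (Some f).
Hypothesis pn : p * n%:R = d.

(** An edge costs its level plus [M], and the exponent [1 - delta / 4] keeps the
    exponential moments of a Weibull level finite. *)
Definition row_cost (delta : R) (f : option 'I_N) : R :=
  if f is Some l then (1 - delta / 4) * (l%:R + M) else 0.

(** The exponential moment of a present edge is of order [L^(1 - delta/4)], so the
    whole row contributes [o(L)], and the [n = e^L] rows are beaten by the excess
    [delta L / 2] of the threshold. *)
Lemma row_cost_prob (C delta : R) : 0 < C -> 0 < delta <= 1 ->
  (forall l : 'I_N, pi (Some l) <= p * (C * expR (- l%:R))) ->
  4 * (d * (C / (1 - expR (- (delta / 4))))) / delta <= expR (delta / 4 * M) ->
  prodPr pi (fun a => exists i, (1 - delta / 4) * ((1 + delta) * L) <=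
    \sum_j row_cost delta (mark a i j)) <= expR (- (delta / 4 * L)).
Proof.
move=> C0 /andP[de0 de1] hpi hM.
have u0 f : 0 <= row_cost delta f.
  have e0 : 0 <= 1 - delta / 4 by lra.
  by case: f => [l|] //=; rewrite mulr_ge0// addr_ge0// ltW.
apply: le_trans (prodPr_row pi_ge0 pi_sum1 _ (erefl _ : row_cost delta None = 0) u0) _.
set q := expR (- (delta / 4)) in hM.
have q01 : 0 <= q < 1.
  by rewrite /q expR_ge0 /= expR_lt1; lra.
have p0 : 0 <= p by apply: sumr_ge0.
set B := \sum_f _.
have hB : B * n%:R <= d * (C / (1 - q)) * expR ((1 - delta / 4) * M).
  rewrite -pn -mulrA [leLHS]mulrC -[leRHS]mulrA [leRHS]mulrCA ler_wpM2l//.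
  apply: (@le_trans _ _ (\sum_(l < N) p * (C * expR ((1 - delta / 4) * M)) * q ^+ l)).
    apply: ler_sum => l _ /=.
    apply: le_trans (ler_wpM2r (expR_ge0 _) (hpi l)) _.
    have -> : q ^+ l = expR (l%:R * - (delta / 4)) by rewrite expRM_natl.
    rewrite -[leRHS]mulrA -[leLHS]mulrA ler_wpM2l// -!mulrA ler_wpM2l ?(ltW C0)//.
    rewrite -!expRD ler_expR; lra.
  rewrite -mulr_sumr [leRHS](_ : _ = p * (C * expR ((1 - delta / 4) * M)) * (1 - q)^-1); last by ring.
  rewrite ler_wpM2l ?geometric_sum_le//.
  by rewrite !mulr_ge0 ?expR_ge0// ltW.
rewrite nL -expRD ler_expR.
have h1 : d * (C / (1 - q)) * expR ((1 - delta / 4) * M) <= delta / 4 * L.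
  have -> : L = expR (delta / 4 * M) * expR ((1 - delta / 4) * M).
    by rewrite LM -expRD; congr expR; ring.
  rewrite [leRHS]mulrA ler_wpM2r ?expR_ge0//.
  by move: hM; rewrite ler_pdivrMr//; lra.
have L0 : 0 < L by rewrite LM expR_gt0.
have h2 : delta * delta * L <= delta * L by rewrite (ler_wpM2r (ltW L0))// ger_pMl.
rewrite -/q nL in hB *.
lra.
Qed.

(** Common conclusion for stars and spiders: [z] is the logarithmic cost of one
    hub with its edges, at most [- eta L / 6], and [r] hubs beat the factor [n]. *)
Let hub_rate (eta : R) (r : nat) (z : R) : 0 < eta ->
  18 * d <= eta * expR (M / 3) -> 12 <= eta * r%:R ->
  z <= 3 * (d * expR (2 * (M / 3))) - eta * L / 3 ->
  n%:R * expR z ^+ r <= expR (- L).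
Proof.
move=> eta0 h1 h2 hz.
have L0 : 0 < L by rewrite LM expR_gt0.
have h3 : 3 * (d * expR (2 * (M / 3))) <= eta * L / 6.
  have -> : L = expR (M / 3) * expR (2 * (M / 3)).
    by rewrite LM -expRD; congr expR; lra.
  by have := ler_wpM2r (expR_ge0 (2 * (M / 3))) h1; lra.
rewrite nL -expRM_natl -expRD ler_expR.
have : r%:R * z <= r%:R * (- (eta * L / 6)) by rewrite ler_wpM2l//; lra.
have := ler_wpM2r (ltW L0) h2; lra.
Qed.

Let BnE theta : (p * expR theta) * n%:R = d * expR theta.
Proof. by rewrite mulrAC pn. Qed.

Lemma hub_star_prob (eta : R) (r : nat) : 0 < eta ->
  18 * d <= eta * expR (M / 3) -> 12 <= eta * r%:R ->
  prodPr pi (fun a => exists h f,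
    @hub_star n (mgraph a) (hubs a (eta * L / M)) r h f) <= expR (- L).
Proof.
move=> eta0 h1 h2.
have t0 : 0 <= M / 3 by rewrite divr_ge0// ltW.
apply: le_trans (prodPr_hub_star pi_ge0 pi_sum1 r (eta * L / M) t0 (erefl _)) _.
rewrite -/p BnE; set z := d * expR (2 * (M / 3)).
have z0 : 0 <= z by rewrite mulr_ge0 ?expR_ge0// ltW.
have -> : n%:R * (p * expR (2 * (M / 3))) = z by rewrite mulrC BnE.
apply: (@le_trans _ _ (n%:R * expR (2 * z - eta * L / 3) ^+ r)).
  rewrite ler_wpM2l// lerXn2r ?nnegrE ?expR_ge0 ?(mulr_ge0 z0) ?expR_ge0//.
  have -> : 2 * z - eta * L / 3 = z + (z - M / 3 * (eta * L / M)).
    by field; rewrite gt_eqF.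
  rewrite [leRHS]expRD ler_wpM2r ?expR_ge0//.
  by apply: le_trans (expR_ge1Dx _); rewrite lerDr.
by apply: (hub_rate eta0) => //; rewrite -/z; lra.
Qed.

Lemma hub_spider_prob (eta : R) (r : nat) : 0 < eta ->
  18 * d <= eta * expR (M / 3) -> 12 <= eta * r%:R ->
  prodPr pi (fun a => exists h u w,
    @hub_spider n (mgraph a) (hubs a (eta * L / M)) r h u w) <= expR (- L).
Proof.
move=> eta0 h1 h2.
have t0 : 0 <= M / 3 by rewrite divr_ge0// ltW.
apply: le_trans (prodPr_hub_spider pi_ge0 pi_sum1 r (eta * L / M) t0 (erefl _)) _.
rewrite -/p BnE; set z := d * expR (2 * (M / 3)).
have z0 : 0 <= z by rewrite mulr_ge0 ?expR_ge0// ltW.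
have -> : n%:R * (p * expR (2 * (M / 3))) = z by rewrite mulrC BnE.
apply: (@le_trans _ _ (n%:R * expR (3 * z - eta * L / 3) ^+ r)).
  rewrite ler_wpM2l// lerXn2r ?nnegrE ?expR_ge0 ?(mulr_ge0 (sqr_ge0 z)) ?expR_ge0//.
  have -> : 3 * z - eta * L / 3 = 2 * z + (z - M / 3 * (eta * L / M)).
    by field; rewrite gt_eqF.
  rewrite [leRHS]expRD ler_wpM2r ?expR_ge0// expRM_natl lerXn2r ?nnegrE ?expR_ge0//.
  by apply: le_trans (expR_ge1Dx _); rewrite lerDr.
by apply: (hub_rate eta0) => //; rewrite -/z; lra.
Qed.

Lemma codegree_prob :
  prodPr pi (fun a => ~ codegree_le2 (mgraph a)) <= d ^+ 6 * expR (- L).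
Proof.
apply: le_trans (prodPr_codegree (n := n) pi_ge0 pi_sum1) _.
rewrite -/p -pn exprMn expRN -nL le_eqVlt; apply/orP; left; apply/eqP.
by field; rewrite pnatr_eq0 -lt0n.
Qed.

Lemma not_dense_prob (b : nat) : 6 + 2 * (d * expR 1) <= b%:R ->
  prodPr pi (fun a => ~ density_le (mgraph a) b) <= 2 * expR (- L).
Proof.
move=> hb; apply: le_trans (prodPr_not_dense pi_ge0 pi_sum1 n0 (ltW d0) pn hb) _.
have nR : 0 < n%:R :> R by rewrite ltr0n.
rewrite expRN -nL -natr1 ler_pdivrMr ?exprn_gt0//.
rewrite [leRHS](_ : _ = 2 * n%:R); last by field; rewrite gt_eqF.
by rewrite mulr2n mulrDl mul1r lerD2l ler1n.
Qed.

(** On these marked graphs the rest of the argument is deterministic: the upper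
    bound holds, and the lower bound holds as soon as there is a good star. *)
Definition tame (delta eta : R) (b r : nat) a : Prop :=
  [/\ forall i, \sum_j row_cost delta (mark a i j) < (1 - delta / 4) * ((1 + delta) * L),
      density_le (mgraph a) b, codegree_le2 (mgraph a),
      forall h f, ~ @hub_star n (mgraph a) (hubs a (eta * L / M)) r h f &
      forall h u w, ~ @hub_spider n (mgraph a) (hubs a (eta * L / M)) r h u w].

Lemma not_tame_prob (C delta eta : R) (b r : nat) :
  0 < C -> 0 < delta <= 1 -> 0 < eta ->
  (forall l : 'I_N, pi (Some l) <= p * (C * expR (- l%:R))) ->
  4 * (d * (C / (1 - expR (- (delta / 4))))) / delta <= expR (delta / 4 * M) ->
  18 * d <= eta * expR (M / 3) -> 12 <= eta * r%:R ->
  6 + 2 * (d * expR 1) <= b%:R ->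
  prodPr pi (fun a => ~ tame delta eta b r a) <=
    (d ^+ 6 + 5) * expR (- (delta / 4 * L)).
Proof.
move=> C0 de01 eta0 hpi h1 h2 h3 h4; have /andP[de0 de1] := de01.
have L0 : 0 < L by rewrite LM expR_gt0.
have eL : expR (- L) <= expR (- (delta / 4 * L)).
  by rewrite ler_expR lerN2 ger_pMl//; lra.
have p1 := row_cost_prob C0 de01 hpi h1.
have p2 := not_dense_prob h4.
have p3 := codegree_prob.
have p4 := hub_star_prob eta0 h2 h3.
have p5 := hub_spider_prob eta0 h2 h3.
set A1 := fun a => _ in p1; set A2 := fun a => _ in p2; set A3 := fun a => _ in p3.
set A4 := fun a => _ in p4; set A5 := fun a => _ in p5.
apply: (@le_trans _ _ (prodPr pi (fun a => A1 a \/ (A2 a \/ (A3 a \/ (A4 a \/ A5 a)))))).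
  apply: prodPr_sub => // a nt; apply: contrapT => h; apply: nt; split.
  - by move=> i; rewrite ltNge; apply/negP => hi; apply: h; left; exists i.
  - by apply: contrapT => hi; apply: h; right; left.
  - by apply: contrapT => hi; apply: h; right; right; left.
  - by move=> x f hf; apply: h; right; right; right; left; exists x, f.
  - by move=> x u w hf; apply: h; right; right; right; right; exists x, u, w.
have q1 := prodPr_or pi_ge0 A1 (fun a => A2 a \/ (A3 a \/ (A4 a \/ A5 a))).
have q2 := prodPr_or pi_ge0 A2 (fun a => A3 a \/ (A4 a \/ A5 a)).
have q3 := prodPr_or pi_ge0 A3 (fun a => A4 a \/ A5 a).
have q4 := prodPr_or pi_ge0 A4 A5.
have := ler_wpM2l (exprn_ge0 6 (ltW d0)) eL.
rewrite mulrDl; lra.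
Qed.

End EventProbabilities.

(** * From the probability space to the product model *)

Section FsbigPred.
Local Open Scope classical_set_scope.
Local Open Scope ring_scope.
Lemma fsbig_pred (R : realType) (I : finType) (A : pred I) (f : I -> \bar R) :
  (\sum_(i \in [set` A]) f i = \sum_(i | A i) f i)%E.
Proof.
rewrite [in LHS](_ : [set` A] = [set` enum A]); last first.
  by apply/seteqP; split=> i /=; rewrite mem_enum.
by rewrite -fsbig_seq ?enum_uniq// big_enum.
Qed.
End FsbigPred.

Section MarkLaw.
Local Open Scope classical_set_scope.
Local Open Scope ring_scope.
Context {R : realType} {d : measure_display} {T : measurableType d}.
Context (P : probability T R) {n : nat} (p : R) (G : T -> rel 'I_n)
  (Y : T -> 'M[R]_n) (mu : probability (measurableTypeR R) R).
Hypotheses (hG : erdos_renyi P p G) (hY : symmetric_iid_mx P mu Y)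
  (hGY : independent_mx P (fun w => adjacency_mx (G w)) Y).
Context {F : finType} (phi : R -> F).
Hypothesis mphi : forall f, measurable (phi @^-1` [set f]).

Definition edge_mark (w : T) (e : upper_pair n) : option F :=
  if G w (val e).1 (val e).2 then Some (phi (Y w (val e).1 (val e).2)) else None.

Definition mark_pmf (f : option F) : R :=
  if f is Some f then p * fine (mu (phi @^-1` [set f])) else 1 - p.

Let sigma_mx_bigcap (M : T -> 'M[R]_n) (J : {set upper_pair n})
    (B : upper_pair n -> set R) :
  (forall e, measurable (B e)) ->
  sigma_mx M (\bigcap_(e in [set` J]) (fun w => M w (val e).1 (val e).2) @^-1` B e).
Proof.
move=> mB.
apply: (@fin_bigcap_measurable _ (g_sigma_algebraType
  (\bigcup_(ij in [set: 'I_n * 'I_n])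
        preimage_set_system setT (fun w => M w ij.1 ij.2) measurable))).
  exact: finite_finset.
move=> e _; apply: sub_sigma_algebra; exists (val e) => //.
by exists (B e) => //; rewrite setTI.
Qed.

(** A mark constrains the adjacency and, only when the edge is present, the
    weight; hence the event splits into one for the graph and one for the
    weights, which are independent of each other. *)
Lemma mark_law (J : {set upper_pair n}) (a : upper_pair n -> option F) :
  let E := [set w | forall e, e \in J -> edge_mark w e = a e] in
  measurable E /\ P E = (\prod_(e in J) mark_pmf (a e))%:E.
Proof.
move=> E; have [_ mG PG indG] := hG; have [_ _ mY PY indY] := hY.
pose b e := a e != None.
pose C e : set R := if a e is Some f then phi @^-1` [set f] else setT.
have mC e : measurable (C e) by rewrite /C; case: (a e) => // f; exact: mphi.
pose A1 := \bigcap_(e in [set` J]) (fun w => G w (val e).1 (val e).2) @^-1` [set b e].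
pose A2 := \bigcap_(e in [set` J]) (fun w => Y w (val e).1 (val e).2) @^-1` (C e).
have EA : E = A1 `&` A2.
  apply/seteqP; split=> w /=.
    move=> h; split=> e /= eJ; have := h e eJ; rewrite /edge_mark /b /C.
      by case: (G w _ _) => <-.
    by case: (G w _ _) => <-.
  move=> [h1 h2] e eJ; have /= := h1 e eJ; have /= := h2 e eJ.
  rewrite /edge_mark /b /C; case: (a e) => [f|] /= + -> //.
  by move=> <-.
have mA1 : measurable A1.
  apply: fin_bigcap_measurable; first exact: finite_finset.
  by move=> e _; rewrite -[X in measurable X]setTI; apply: mG.
have mA2 : measurable A2.
  apply: fin_bigcap_measurable; first exact: finite_finset.
  by move=> e _; rewrite -[X in measurable X]setTI; apply: mY.
have s1 : sigma_mx (fun w => adjacency_mx (G w) : 'M[R]_n) A1.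
  have -> : A1 = \bigcap_(e in [set` J])
      (fun w => (adjacency_mx (G w) : 'M[R]_n) (val e).1 (val e).2) @^-1` [set (b e)%:R].
    apply: eq_bigcapr => e _; apply/seteqP; split=> w /=; rewrite mxE.
      by move=> ->.
    by move/eqP; rewrite eqr_nat; case: (G w _ _); case: (b e).
  have mB e : measurable [set (b e)%:R : R] by exact: measurable_set1.
  exact (@sigma_mx_bigcap (fun w => adjacency_mx (G w)) J
    (fun e => [set (b e)%:R]) mB).
have s2 : sigma_mx Y A2 by exact (sigma_mx_bigcap J mC).
split; first by rewrite EA; exact: measurableI.
rewrite EA (hGY s1 s2) (indG J (fun e => [set b e])) // (indY J C)//.
rewrite -big_split/= -prodEFin; apply: eq_bigr => e _.
rewrite PY ?(valP e)// /b /C.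
have fmu f : mu (phi @^-1` [set f]) \is a fin_num by apply: fin_num_measure; exact: mphi.
have PGe : P [set w | G w (val e).1 (val e).2] = p%:E := PG _ _ (valP e).
case: (a e) => [f|] /=.
  by rewrite EFinM fineK//; congr (_ * _)%E; rewrite -PGe.
rewrite probability_setT mule1 EFinB -PGe -probability_setC; last first.
  by rewrite -[X in measurable X]setTI; exact: (mG _ _ _ [set true]).
by congr (P _); apply/seteqP; split=> w /=; case: (G w _ _).
Qed.

Lemma mark_pmf_ge0 f : 0 <= p <= 1 -> 0 <= mark_pmf f.
Proof.
move=> /andP[p0 p1]; case: f => [f|] /=; last by rewrite subr_ge0.
by rewrite mulr_ge0// fine_ge0.
Qed.

Lemma sum_fiber_pmf : \sum_f fine (mu (phi @^-1` [set f])) = 1.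
Proof.
apply: EFin_inj; rewrite -sumEFin.
have fmu f : mu (phi @^-1` [set f]) \is a fin_num.
  by apply: fin_num_measure; exact: mphi.
under eq_bigr do rewrite (fineK (fmu _)).
rewrite -(@probability_setT _ _ _ mu).
have -> : [set: R] = \bigcup_(f in [set: F]) phi @^-1` [set f].
  by apply/seteqP; split=> // y _; exists (phi y).
rewrite measure_fin_bigcup//; [|exact: finite_finset| |by move=> f _; exact: mphi]; last first.
  by move=> f g _ _ [y [/= <- <-]].
rewrite (_ : [set: F] = [set` predT]); last by apply/seteqP.
by rewrite fsbig_pred.
Qed.

Lemma sum_mark_pmf_Some : \sum_f mark_pmf (Some f) = p.
Proof. by rewrite /= -mulr_sumr sum_fiber_pmf mulr1. Qed.

Lemma sum_mark_pmf : \sum_f mark_pmf f = 1.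
Proof. by rewrite sum_option sum_mark_pmf_Some /= subrK. Qed.

(** The event [B] is covered by the cells on which all marks are fixed; there are
    finitely many of them and [mark_law] gives their probabilities. *)
Lemma prob_le_prodPr (A : {ffun upper_pair n -> option F} -> Prop) (B : set T) :
  measurable B -> (forall w, B w -> A [ffun e => edge_mark w e]) ->
  (P B <= (prodPr mark_pmf A)%:E)%E.
Proof.
move=> mB BA.
pose E (a : {ffun upper_pair n -> option F}) :=
  [set w | forall e, e \in [set: upper_pair n]%SET -> edge_mark w e = a e].
have mE a : measurable (E a) by have [] := mark_law [set: upper_pair n]%SET a.
have PE a : P (E a) = (\prod_e mark_pmf (a e))%:E.
  have [_ ->] := mark_law [set: upper_pair n]%SET a.
  by congr EFin; apply: eq_bigl => e; rewrite finset.in_setT.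
pose D := [set` [pred a : {ffun upper_pair n -> option F} | `[< A a >]]].
apply: (@le_trans _ _ (P (\bigcup_(a in D) E a))).
  apply: le_measure; rewrite ?inE//.
    by apply: fin_bigcup_measurable => //; exact: finite_finset.
  move=> w /BA Aw; exists [ffun e => edge_mark w e]; first exact/asboolP.
  by move=> e _; rewrite ffunE.
rewrite measure_fin_bigcup//; [|exact: finite_finset|]; last first.
  move=> a a' _ _ [w [/= ha ha']]; apply/ffunP => e.
  by rewrite -ha ?finset.in_setT// ha' ?finset.in_setT.
rewrite /D fsbig_pred /prodPr -sumEFin le_eqVlt; apply/orP; left; apply/eqP.
by apply: eq_bigr => a _; exact: PE.
Qed.

End MarkLaw.

Section WeibullLevels.
Local Open Scope classical_set_scope.
Local Open Scope ring_scope.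
Context {R : realType}.

(** The mark of a weight [y] is an upper bound of [|y|^alpha] as long as it is
    less than the cap [N]. *)
Definition level (alpha : R) (N : nat) (y : R) : 'I_N.+1 :=
  inord (minn (Num.trunc (`|y| `^ alpha)).+1 N).

Lemma val_level alpha N y :
  level alpha N y = minn (Num.trunc (`|y| `^ alpha)).+1 N :> nat.
Proof. by rewrite inordK// ltnS geq_minr. Qed.

Lemma level_ge alpha N y : (level alpha N y < N)%N ->
  `|y| `^ alpha <= (level alpha N y)%:R.
Proof.
rewrite val_level => h; have /andP[_ /ltW] := truncn_itv (powR_ge0 `|y| alpha).
by move/le_trans; apply; rewrite ler_nat; lia.
Qed.

Let tail (alpha : R) (k : nat) : set R := [set y | k%:R <= `|y| `^ alpha].

Let measurable_tail alpha k : measurable (tail alpha k : set (measurableTypeR R)).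
Proof.
have mf : measurable_fun setT (fun y : measurableTypeR R => `|y| `^ alpha).
  exact: measurableT_comp (measurable_powR alpha) (@normr_measurable R setT).
have := mf measurableT `[k%:R, +oo[%classic (measurable_itv _).
by rewrite setTI; congr measurable; apply/seteqP; split => y /=; rewrite in_itv/= andbT.
Qed.

Let levelE alpha N (a : 'I_N.+1) : (0 < N)%N ->
  level alpha N @^-1` [set a] =
  (if (0 < a)%N then tail alpha a.-1 else set0) `&`
  (if (a < N)%N then ~` tail alpha a else setT).
Proof.
move=> N0; have tailE k y : tail alpha k y = (k <= Num.trunc (`|y| `^ alpha))%N :> Prop.
  by rewrite /tail/= truncn_ge_nat// powR_ge0.
have an := ltn_ord a.
apply/seteqP; split => y /=.
  move=> /(congr1 val); rewrite /= val_level => ya.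
  have -> : (0 < a)%N by lia.
  split; first by rewrite tailE; lia.
  by case: ifP => // h /=; rewrite tailE; lia.
case: ifP => [a0|_ []//].
case: ifP => h [] /=; rewrite !tailE => h1 h2; apply: val_inj; rewrite /= val_level; lia.
Qed.

Lemma measurable_level alpha N a : (0 < N)%N ->
  measurable (level alpha N @^-1` [set a] : set (measurableTypeR R)).
Proof.
move=> N0; rewrite levelE//; apply: measurableI; case: ifP => // _.
by apply: measurableC; exact: measurable_tail.
Qed.

(** Rounding up costs a factor [e], and the levels up to [2], where the tail
    bound is void, are absorbed in the constant. *)
Lemma weibull_level (alpha : R) (mu : probability (measurableTypeR R) R) :
  weibull alpha mu -> exists2 C : R, 0 < C & forall N (a : 'I_N.+1), (0 < N)%N ->
    fine (mu (level alpha N @^-1` [set a])) <= C * expR (- a%:R).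
Proof.
move=> [a0 [C1 [C2 [C10 C20 hC]]]].
exists (expR 2 + C2 * expR 1) => [|N a N0].
  by rewrite addr_gt0 ?expR_gt0// mulr_gt0// expR_gt0.
have ma := measurable_level alpha a N0.
rewrite -lee_fin fineK ?fin_num_measure//.
have [a2|a2] := leqP a 2.
  apply: le_trans (probability_le1 _ ma) _; rewrite lee_fin mulrDl -expRD.
  rewrite -[leLHS]addr0 lerD//; last by rewrite !mulr_ge0 ?expR_ge0 ?ltW.
  by apply: le_trans (expR_ge1Dx _); move: a2; rewrite -(ler_nat R); lra.
pose t : R := a.-1%:R `^ alpha^-1.
have tal : t `^ alpha = a.-1%:R.
  by rewrite -powRrM mulVf ?gt_eqF// powRr1.
have t1 : 1 < t.
  have -> : 1 = 1 `^ alpha^-1 :> R by rewrite powR1.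
  rewrite gt0_ltr_powR ?invr_gt0 ?nnegrE// ltr1n; lia.
have [/andP[_ h1] /andP[_ h2]] := hC t t1.
have mt : measurable [set x : measurableTypeR R | (t <= x)%R].
  by have := @measurable_itv R `[t, +oo[; congr measurable; apply/seteqP;
    split => y /=; rewrite in_itv/= andbT.
have mt' : measurable [set x : measurableTypeR R | (x <= - t)%R].
  by have := @measurable_itv R `]-oo, - t]; congr measurable; apply/seteqP;
    split => y /=; rewrite in_itv.
apply: (@le_trans _ _ (mu ([set x : R | (t <= x)%R] `|` [set x : R | (x <= - t)%R]))).
  apply: le_measure; rewrite ?inE//; first exact: measurableU.
  rewrite levelE//; case: ifP => [_|]; last by lia.
  move=> y [+ _]; rewrite /tail/= => h.
  have : t <= `|y|.
    rewrite leNgt; apply/negP => yt.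
    have : `|y| `^ alpha < t `^ alpha.
      by rewrite gt0_ltr_powR// ?nnegrE// ltW// (lt_trans ltr01).
    by rewrite tal ltNge h.
  by rewrite ler_normr => /orP[|]; [left|right; rewrite lerNr].
apply: le_trans (measureU2 _ mt mt') _.
apply: le_trans (leeD h1 h2) _; rewrite -EFinD lee_fin tal.
have -> : - a.-1%:R = 1 - a%:R :> R by rewrite -subn1 natrB ?opprB//; lia.
rewrite expRD mulrDl -mulrA.
have : 0 <= expR 2 * expR (- a%:R) :> R by rewrite mulr_ge0 ?expR_ge0.
lra.
Qed.

End WeibullLevels.

Section BinomialTail.
Local Open Scope classical_set_scope.
Local Open Scope ring_scope.
Context {R : realType} {I F : finType} (pi : F -> R) (f0 : F).
Hypotheses (pi_ge0 : forall f, 0 <= pi f) (pi_sum1 : \sum_f pi f = 1).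

(** Only the configurations with exactly [k] successes are counted. *)
Lemma prodPr_binomial_ge (k : nat) :
  'C(#|I|, k)%:R * (pi f0 ^+ k * (1 - pi f0) ^+ (#|I| - k)) <=
  prodPr pi (fun a : {ffun I -> F} => (k <= #|[set i | a i == f0]%SET|)%N).
Proof.
pose succ (a : {ffun I -> F}) : {set I} := [set i | a i == f0]%SET.
have hS (S : {set I}) : #|S| = k ->
    \sum_(a : {ffun I -> F} | succ a == S) \prod_i pi (a i) =
    pi f0 ^+ k * (1 - pi f0) ^+ (#|I| - k).
  move=> Sk.
  pose g i f := pi f * ((f == f0) == (i \in S))%:R.
  have -> : pi f0 ^+ k * (1 - pi f0) ^+ (#|I| - k) = \prod_i \sum_f g i f.
    have sumg i : \sum_f g i f = if i \in S then pi f0 else 1 - pi f0.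
      rewrite /g; case: ifP => _.
        rewrite (bigD1 f0)//= eqxx mulr1 big1 ?addr0// => f /negbTE ->.
        by rewrite mulr0.
      have -> : 1 - pi f0 = \sum_(f | f != f0) pi f.
        by have := pi_sum1; rewrite (bigD1 f0)//=; lra.
      rewrite (bigD1 f0)//= eqxx mulr0 add0r.
      by apply: eq_bigr => f /negbTE ->; rewrite mulr1.
    rewrite (eq_bigr _ (fun i _ => sumg i)).
    rewrite (bigID (mem S))/=; congr (_ * _).
      rewrite (eq_bigr (fun=> pi f0)) => [|i ->//].
      by rewrite prodr_const Sk.
    rewrite (eq_bigr (fun=> 1 - pi f0)) => [|i /negbTE ->//].
    rewrite prodr_const -Sk; congr (_ ^+ _).
    by rewrite -(cardC (mem S)) addKn; apply: eq_card.
  rewrite bigA_distr_bigA big_mkcond/=; apply: eq_bigr => a _.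
  rewrite big_split/=; case: eqP => [aS|aS].
    by rewrite [X in _ * X]big1 ?mulr1// => i _; rewrite -aS inE eqxx.
  have /forallPn[i hi] : ~~ [forall i, (a i == f0) == (i \in S)].
    apply/negP => /forallP h; apply: aS; apply/setP => i; rewrite inE.
    exact: (eqP (h i)).
  by rewrite [X in _ * X](bigD1 i)//= (negbTE hi) mul0r mulr0.
have -> : 'C(#|I|, k)%:R * (pi f0 ^+ k * (1 - pi f0) ^+ (#|I| - k)) =
    \sum_(S : {set I} | #|S| == k) \sum_(a : {ffun I -> F} | succ a == S) \prod_i pi (a i).
  rewrite (eq_bigr _ (fun S Sk => hS S (eqP Sk))) sumr_const mulr_natl; congr (_ *+ _).
  by rewrite -card_draws; apply: eq_card => S; rewrite !inE.
rewrite (exchange_big_dep xpredT)//= /prodPr [leRHS]big_mkcond/=.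
apply: ler_sum => a _.
have w0 : 0 <= \prod_i pi (a i) by exact: prodr_ge0.
have [ak|ak] := eqVneq #|succ a| k.
  rewrite (big_pred1 (succ a)) => [|S]; first by rewrite asboolT// /succ ak.
  by rewrite /= [succ a == S]eq_sym andb_idl// => /eqP ->; rewrite ak.
rewrite big_pred0 => [|S]; first by case: ifP.
by apply/negP => /andP[/eqP Sk /eqP aS]; rewrite aS Sk eqxx in ak.
Qed.
End BinomialTail.

Lemma prodPr_compl (R : realType) (I F : finType) (pi : F -> R)
    (A B : {ffun I -> F} -> Prop) : \sum_f pi f = 1 ->
  (forall a, A a <-> ~ B a) -> prodPr pi A = 1 - prodPr pi B.
Proof.
move=> pi1 AB; have : \sum_(a : {ffun I -> F}) \prod_i pi (a i) = 1.
  by rewrite -(bigA_distr_bigA (fun _ => pi))/= big1.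
rewrite (bigID (fun a => `[< B a >]))/= -/(prodPr pi B) => h.
suff -> : prodPr pi A = \sum_(a | ~~ `[< B a >]) \prod_i pi (a i) by lra.
by apply: eq_bigl => a; rewrite -asbool_neg; apply: asbool_equiv_eq.
Qed.

Section StarEdges.
Local Open Scope classical_set_scope.
Local Open Scope ring_scope.
Context {n m : nat} (mn : (m.*2 <= n)%N).

Let center_lt (c : 'I_m) : (c < n)%N.
Proof. by apply: leq_trans (ltn_ord c) (leq_trans _ mn); rewrite -addnn leq_addr. Qed.

Let leaf_lt (u : 'I_m) : (m + u < n)%N.
Proof. by apply: leq_trans mn; rewrite -addnn ltn_add2l. Qed.

Definition star_center (c : 'I_m) : 'I_n := Ordinal (center_lt c).
Definition star_leaf (u : 'I_m) : 'I_n := Ordinal (leaf_lt u).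

Let center_leaf c u : (star_center c < star_leaf u)%N.
Proof. by rewrite /= ltn_addr. Qed.

Definition star_edge (x : 'I_m * 'I_m) : upper_pair n :=
  exist _ (star_center x.1, star_leaf x.2) (center_leaf x.1 x.2).

Lemma star_leaf_inj : injective star_leaf.
Proof. by move=> u v /(congr1 val)/addnI/val_inj. Qed.

Lemma star_edge_inj : injective star_edge.
Proof.
move=> [c u] [c' u'] /(congr1 val)/= E.
have /val_inj -> : val c = val c' by exact: (congr1 (fun x => val x.1) E).
by rewrite (star_leaf_inj (congr1 snd E)).
Qed.
End StarEdges.

Section NoStar.
Local Open Scope classical_set_scope.
Local Open Scope ring_scope.
Context {R : realType} {d : measure_display} {T : measurableType d}.
Context (P : probability T R) {n : nat} (p : R) (G : T -> rel 'I_n)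
  (Y : T -> 'M[R]_n) (mu : probability (measurableTypeR R) R).
Hypotheses (hG : erdos_renyi P p G) (hY : symmetric_iid_mx P mu Y)
  (hGY : independent_mx P (fun w => adjacency_mx (G w)) Y).
Hypothesis p01 : 0 <= p <= 1.
Context {F : finType} (phi : R -> F).
Hypothesis mphi : forall f, measurable (phi @^-1` [set f]).
Context {m : nat} (mn : (m.*2 <= n)%N).

(** The rows of the complete bipartite graph between centres and leaves are
    disjoint sets of edges, hence independent. *)
Lemma no_star_prob (f0 : option F) (k : nat) :
  let pi := mark_pmf p mu phi in
  let E := [set w | forall c : 'I_m,
    (#|[set u : 'I_m | edge_mark G Y phi w (star_edge mn (c, u)) == f0]%SET| < k)%N] in
  measurable E /\
  (P E <= (expR (- (m%:R * ('C(m, k)%:R * (pi f0 ^+ k * (1 - pi f0) ^+ (m - k))))))%:E)%E.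
Proof.
move=> pi E.
have pi0 f : 0 <= pi f by exact: mark_pmf_ge0.
have pi1 : \sum_f pi f = 1 by exact: sum_mark_pmf.
pose conf := {ffun 'I_m -> {ffun 'I_m -> option F}}.
pose fail (row : {ffun 'I_m -> option F}) : Prop :=
  (#|[set u | row u == f0]%SET| < k)%N.
pose ext (a : conf) (e : upper_pair n) : option F :=
  if [pick x | star_edge mn x == e] is Some x then a x.1 x.2 else None.
have extE a x : ext a (star_edge mn x) = a x.1 x.2.
  rewrite /ext; case: pickP => [y /eqP/star_edge_inj -> //|/(_ x)].
  by rewrite eqxx.
pose J : {set upper_pair n} := (star_edge mn @: [set: 'I_m * 'I_m])%SET.
pose Ea (a : conf) := [set w | forall e, e \in J -> edge_mark G Y phi w e = ext a e].
have mEa a : measurable (Ea a) := (mark_law hG hY hGY mphi J (ext a)).1.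
have PEa a : P (Ea a) = (\prod_c \prod_u pi (a c u))%:E.
  rewrite (mark_law hG hY hGY mphi J (ext a)).2; congr EFin.
  rewrite /J (big_imset _ (in2W (@star_edge_inj _ _ mn)))/=.
  under eq_bigl do rewrite finset.in_setT.
  rewrite pair_big/=; apply: eq_bigr => x _; by rewrite extE.
pose D := [set` [pred a : conf | `[< forall c, fail (a c) >]]].
have EE : E = \bigcup_(a in D) Ea a.
  apply/seteqP; split => w /=.
    move=> Ew; exists [ffun c => [ffun u => edge_mark G Y phi w (star_edge mn (c, u))]].
      apply/asboolP => c; apply: leq_ltn_trans (Ew c).
      by apply: subset_leq_card; apply/fintype.subsetP => u; rewrite !inE !ffunE.
    by move=> e /imsetP[[c u] _ ->]; rewrite extE !ffunE.
  case=> a /asboolP ha hw c; apply: leq_ltn_trans (ha c).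
  apply: subset_leq_card; apply/fintype.subsetP => u; rewrite !inE.
  by rewrite hw ?extE// imset_f.
split.
  by rewrite EE; apply: fin_bigcup_measurable => //; exact: finite_finset.
rewrite EE measure_fin_bigcup//; [|exact: finite_finset|]; last first.
  move=> a a' _ _ [w [/= ha ha']]; apply/ffunP => c; apply/ffunP => u.
  have eJ : star_edge mn (c, u) \in J by rewrite imset_f.
  by rewrite -(extE a (c, u)) -(extE a' (c, u)) -ha// ha'.
rewrite fsbig_pred (eq_bigr _ (fun a _ => PEa a)) sumEFin lee_fin.
have -> : \sum_(a : conf | `[< forall c, fail (a c) >]) \prod_c \prod_u pi (a c u) =
    prodPr pi fail ^+ m.
  have -> : prodPr pi fail ^+ m = \prod_(c < m) prodPr pi fail.
    by rewrite prodr_const card_ord.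
  under [RHS]eq_bigr do rewrite /prodPr big_mkcond/=.
  rewrite bigA_distr_bigA/= big_mkcond/=; apply: eq_bigr => a _.
  case: asboolP => [h|/existsNP[c hc]].
    by apply: eq_bigr => c _; rewrite asboolT.
  by rewrite (bigD1 c)//= asboolF// mul0r.
rewrite mulrC -mulNr mulrC expRM_natl lerXn2r ?nnegrE ?expR_ge0 ?prodPr_ge0//.
rewrite (prodPr_compl (B := fun a => (k <= #|[set u | a u == f0]%SET|)%N) pi1); last first.
  by move=> a; rewrite /fail ltnNge; split => [/negP|/negP].
apply: le_trans (expR_ge1Dx _); rewrite lerD2l lerN2.
by have := prodPr_binomial_ge (I := 'I_m) f0 pi0 pi1 k; rewrite card_ord.
Qed.
End NoStar.

(** * The two bounds on tame graphs *)

Section TameSpectrum.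
Context {R : realType} {T : Type} {n : nat} (G : T -> rel 'I_n) (Y : T -> 'M[R]_n).
Hypotheses (symG : forall w, symmetric (G w) /\ irreflexive (G w))
  (symY : forall w i j, Y w i j = Y w j i).

Definition sparse_mx (w : T) : 'M[R]_n := entrywise_mul (adjacency_mx (G w)) (Y w).

Lemma sparse_mxE w i j : sparse_mx w i j = (G w i j)%:R * Y w i j.
Proof. by rewrite !mxE. Qed.

Lemma sparse_mx_sym w : (sparse_mx w)^T = sparse_mx w.
Proof.
by apply/matrixP => i j; rewrite mxE !sparse_mxE symY; congr (_%:R * _); rewrite (symG w).1.
Qed.

Lemma sparse_mx_supp w i j : ~~ G w i j -> sparse_mx w i j = 0.
Proof. by move=> /negbTE h; rewrite sparse_mxE h mul0r. Qed.

Definition sample_marks {F : finType} (phi : R -> F) (w : T) :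
    {ffun upper_pair n -> option F} :=
  [ffun e : upper_pair n => if G w (val e).1 (val e).2
           then Some (phi (Y w (val e).1 (val e).2)) else None].

Lemma mark_sample {F : finType} (phi : R -> F) w i j :
  mark (sample_marks phi w) i j = if G w i j then Some (phi (Y w i j)) else None.
Proof.
have lt (i' j' : 'I_n) : (i' < j')%N -> mark (sample_marks phi w) i' j' =
    if G w i' j' then Some (phi (Y w i' j')) else None.
  by move=> ij; rewrite /mark (edge_of_lt ij)/= ffunE.
have [/lt //|ji|/val_inj ->] := ltngtP i j; last by rewrite mark_diag (symG w).2.
by rewrite markC lt// (symG w).1 symY.
Qed.

Lemma mgraph_sample {F : finType} (phi : R -> F) w :
  mgraph (sample_marks phi w) = G w.
Proof.
apply/funext => i; apply/funext => j; rewrite /mgraph mark_sample.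
by case: (G w i j).
Qed.

Context (alpha L M delta eta : R) (b r N : nat).
Hypotheses (a2 : 2 < alpha) (L0 : 0 < L) (M0 : 0 < M) (de01 : 0 < delta < 1)
  (eta0 : 0 < eta) (LN : 2 * L < N%:R).

Let is_tame w := tame L M delta eta b r (sample_marks (level alpha N) w).

(** A level equal to the cap [N] would exceed the row budget by itself, so no
    edge of a tame graph is capped and the levels bound the weights. *)
Lemma tame_row w i : is_tame w ->
  \sum_(j | G w i j) `|sparse_mx w i j| `^ alpha + M * #|nbrs (G w) i|%:R <=
  (1 + delta) * L.
Proof.
move=> [/(_ i) + _ _ _ _]; have /andP[de0 de1] := de01.
have e0 : 0 < 1 - delta / 4 by lra.
have -> : \sum_j row_cost M delta (mark (sample_marks (level alpha N) w) i j) =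
    (1 - delta / 4) * \sum_(j | G w i j) ((level alpha N (Y w i j))%:R + M).
  rewrite mulr_sumr big_mkcond/= [RHS]big_mkcond/=; apply: eq_bigr => j _.
  by rewrite mark_sample; case: (G w i j).
rewrite ltr_pM2l// => h.
apply: le_trans (ltW h); rewrite big_split/= lerD//; last first.
  by rewrite -sum_nbrs mulr_sumr; apply: ler_sum => j _; rewrite mulr1.
apply: ler_sum => j ij; rewrite sparse_mxE ij mul1r.
apply: level_ge; rewrite -(ltr_nat R); apply: lt_trans LN.
apply: le_lt_trans (lt_trans h _); last by rewrite ltr_pM2r//; lra.
rewrite (bigD1 j)//= -addrA lerDl addr_ge0 ?(ltW M0)//.
by apply: sumr_ge0 => k _; rewrite addr_ge0 ?(ltW M0).
Qed.

Lemma tame_lambda1_le w (kappa : R) : (0 < n)%N -> is_tame w ->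
  0 < kappa -> (0 < b)%N -> 8 * b%:R * eta `^ (1 - 2 / alpha) <= kappa ^+ 2 ->
  (3 * r)%:R <= eta * L / M ->
  lambda1 (sparse_mx w) <= ((1 + delta) * lim_const alpha + kappa) * scale alpha L M.
Proof.
move=> n0 tw k0 b0 hk hr; have /andP[de0 de1] := de01.
have [_ hb C0 C1 C2] := tw; rewrite mgraph_sample in hb C0 C1 C2.
have [symX irrX] := symG w.
apply: (lambda1_le_scale n0 a2 L0 M0 _ eta0 k0 b0 hk symX irrX (sparse_mx_sym w)
  (@sparse_mx_supp w) hb) => [|i|i].
- by rewrite !ltW.
- exact: tame_row.
- set H := (X in rest _ X).
  have HE : H = hubs (sample_marks (level alpha N) w) (eta * L / M).
    by apply/setP => x; rewrite !inE mgraph_sample.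
  have [iH|iH] := boolP (i \in H).
    apply: le_trans hr; rewrite ler_nat; apply: rest_hub_degree => //.
      by move=> h f; rewrite HE; exact: C1.
    by move=> h u v; rewrite HE; exact: C2.
  apply: (@le_trans _ _ #|nbrs (G w) i|%:R); first by rewrite ler_nat rest_degree.
  by move: iH; rewrite !inE -ltNge => /ltW.
Qed.

Lemma tame_lambda1_ge w (c : 'I_n) (S : {set 'I_n}) : is_tame w ->
  (0 < #|S|)%N -> (1 - 2 / alpha) * L / M <= #|S|%:R -> c \notin S ->
  (forall u, u \in S -> G w c u /\
    ((1 - delta) * (2 / alpha) * L / #|S|%:R) `^ alpha^-1 <= Y w c u) ->
  (1 - delta) * (lim_const alpha * scale alpha L M) - b%:R * (2 * L) `^ alpha^-1 <=
    lambda1 (sparse_mx w).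
Proof.
move=> tw S0 hS cS ht; have /andP[de0 de1] := de01.
have [_ hb _ _ _] := tw; rewrite mgraph_sample in hb.
have [symX irrX] := symG w.
apply: (lambda1_ge_scale a2 L0 M0 _ symX irrX (sparse_mx_sym w)
  (@sparse_mx_supp w) hb _ S0 hS cS).
- by rewrite ltW.
- move=> i; apply: (@le_trans _ _ ((1 + delta) * L)).
    apply: le_trans (tame_row i tw); rewrite lerDl mulr_ge0// ltW//.
  by rewrite (ler_wpM2r (ltW L0))//; lra.
- by move=> u /ht[Gu Yu]; rewrite sparse_mxE Gu mul1r.
Qed.

End TameSpectrum.

Lemma bin_ge_expn (m k : nat) : (k <= m)%N -> ((m - k).+1 ^ k <= 'C(m, k) * k ^ k)%N.
Proof.
move=> km; apply: (@leq_trans ('C(m, k) * k`!)); last first.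
  rewrite leq_mul2l; apply/orP; right.
  rewrite fact_prod -[X in (_ <= _ ^ X)%N](subn1 k.+1) -prod_nat_const_nat.
  rewrite big_nat [leqRHS]big_nat; apply: leq_prod => i /andP[_]; by rewrite ltnS.
rewrite bin_ffact ffact_prod -[X in (_ ^ X <= _)%N]card_ord -prod_nat_const.
by apply: leq_prod => i _; rewrite ltn_sub2l// (leq_trans (ltn_ord i)).
Qed.

Section NoStarRate.
Context {R : realType}.

Lemma expRN_le_onem (p : R) : 0 <= p <= 1 / 2 -> expR (- (2 * p)) <= 1 - p.
Proof.
move=> /andP[p0 p1]; rewrite expRN -[leRHS]invrK lef_pV2 ?posrE ?expR_gt0 ?invr_gt0; try lra.
apply: le_trans (expR_ge1Dx _); rewrite -[leLHS]mul1r ler_pdivrMr; last by lra.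
nra.
Qed.

(** Up to lower order terms, a given centre has [k] heavy edges with probability
    [exp (- k ln k - k t^alpha) = exp (- (1 - delta (2 / alpha)) L)], where
    [k t^alpha = (1 - delta) (2 / alpha) L]; there are about [e^L] centres. *)
Lemma no_star_rate (n k : nat) (alpha delta d C1 q L M : R) :
  2 < alpha -> 0 < delta < 1 -> 0 < d -> 0 < C1 -> 0 < M ->
  L = expR M -> n%:R = expR L -> 8 <= L -> 2 * d <= n%:R ->
  (0 < k)%N -> k%:R <= (1 - 2 / alpha) * L / M + 1 -> k%:R <= L ->
  2 * (4 + 2 * `|ln (d * C1 / 8)| + 2 * d) <= delta * (2 / alpha) * M ->
  0 <= q <= 1 -> C1 / 2 * expR (- ((1 - delta) * (2 / alpha) * L / k%:R)) <= q ->
  expR (delta * (2 / alpha) * L / 2) <=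
  (n./2)%:R * ('C(n./2, k)%:R *
    ((d / n%:R * q) ^+ k * (1 - d / n%:R * q) ^+ (n./2 - k))).
Proof.
move=> a2 /andP[de0 de1] d0 C10 M0 LM nL L8 dn k0 hk kL hM /andP[q0 q1] hq.
set m := n./2; set ka := 1 - 2 / alpha in hk *.
have a0 : 0 < alpha by lra.
have th0 : 0 < 2 / alpha by rewrite divr_gt0.
have ka0 : 0 < ka by rewrite /ka subr_gt0 ltr_pdivrMr// mul1r.
have L0 : 0 < L by lra.
have nR : 0 < n%:R :> R by rewrite nL expR_gt0.
have kR : 0 < k%:R :> R by rewrite ltr0n.
have nquad : 1 + L ^+ 2 / 2 <= n%:R :> R by rewrite nL; exact: (expR_ge1Dxn 1 (ltW L0)).
have nL8 : 1 + 4 * L <= n%:R by move: nquad; rewrite expr2; nra.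
have mE : n%:R <= 2 * m%:R + 1 :> R.
  have : (n <= 2 * m + 1)%N by rewrite /m mul2n -{1}(odd_double_half n) addnC leq_add2l leq_b1.
  by rewrite -(ler_nat R) natrD natrM.
have km : (k <= m)%N by rewrite -(ler_nat R); lra.
have mkn : n%:R / 4 <= (m - k).+1%:R :> R.
  by rewrite -[(m - k).+1%:R]natr1 natrB//; lra.
have binB : (n%:R / (4 * k%:R)) ^+ k <= 'C(m, k)%:R :> R.
  have := bin_ge_expn km; rewrite -(ler_nat R) natrM !natrX => h.
  rewrite [X in X ^+ k](_ : _ = n%:R / 4 / k%:R); last by field; rewrite gt_eqF.
  rewrite expr_div_n ler_pdivrMr ?exprn_gt0//; apply: le_trans h.
  by rewrite lerXn2r ?nnegrE// divr_ge0// ltW.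
set p := d / n%:R.
have p0 : 0 < p by rewrite divr_gt0.
have p12 : p <= 1 / 2 by rewrite ler_pdivrMr//; lra.
have p1 : 0 <= 1 - p by clear -p12; lra.
have pq : p * q <= p by rewrite ger_pMr.
have pq0 : 0 <= p * q by rewrite mulr_ge0// ltW.
have missB : expR (- (2 * d)) <= (1 - p * q) ^+ (m - k).
  apply: (@le_trans _ _ ((1 - p) ^+ (m - k))); last first.
    by rewrite lerXn2r ?nnegrE// ?lerD2l ?lerN2//; apply: le_trans p1 _; rewrite lerD2l lerN2.
  apply: (@le_trans _ _ ((1 - p) ^+ n)); last first.
    apply: ler_wiXn2l => //; first by rewrite gerBl ltW.
    apply: leq_trans (leq_subr _ _) _.
    by rewrite /m -{2}(odd_double_half n) -addnn addnA leq_addl.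
  have := expRN_le_onem (p := p); rewrite p12 (ltW p0) => /(_ isT) h.
  have -> : - (2 * d) = n%:R * - (2 * p) by rewrite /p; field; rewrite gt_eqF.
  by rewrite expRM_natl lerXn2r ?nnegrE ?expR_ge0.
set tau := (1 - delta) * (2 / alpha) * L / k%:R in hq.
have hitB : (p * (C1 / 2 * expR (- tau))) ^+ k <= (p * q) ^+ k.
  by rewrite lerXn2r ?nnegrE ?ler_wpM2l ?(ltW p0)// mulr_ge0 ?(ltW p0)// mulr_ge0 ?expR_ge0//; lra.
have mB : n%:R * expR (- 2) <= m%:R :> R.
  have : 1 + 2 <= expR 2 :> R by exact: expR_ge1Dx.
  rewrite expRN ler_pdivrMr ?expR_gt0// => h.
  have : m%:R * 3 <= m%:R * expR 2 :> R by rewrite ler_wpM2l//; lra.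
  lra.
apply: (@le_trans _ _ (n%:R * expR (- 2) * ((n%:R / (4 * k%:R)) ^+ k *
   ((p * (C1 / 2 * expR (- tau))) ^+ k * expR (- (2 * d)))))); last first.
  have c1 : 0 <= p * (C1 / 2 * expR (- tau)).
    by rewrite mulr_ge0 ?(ltW p0)// mulr_ge0 ?expR_ge0//; lra.
  have c2 : 0 <= n%:R / (4 * k%:R) :> R by rewrite divr_ge0// mulr_ge0// ltW.
  have c3 : 0 <= (p * (C1 / 2 * expR (- tau))) ^+ k * expR (- (2 * d)).
    by apply: mulr_ge0; [exact: exprn_ge0|exact: expR_ge0].
  have c4 : 0 <= (n%:R / (4 * k%:R)) ^+ k *
      ((p * (C1 / 2 * expR (- tau))) ^+ k * expR (- (2 * d))).
    by apply: mulr_ge0 c3; exact: exprn_ge0.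
  have c5 : 0 <= n%:R * expR (- 2) :> R by rewrite mulr_ge0 ?expR_ge0// ltW.
  apply: ler_pM c5 c4 mB _.
  apply: ler_pM (exprn_ge0 k c2) c3 binB _.
  exact: ler_pM (exprn_ge0 k c1) (expR_ge0 _) hitB missB.
rewrite [X in _ <= _ * X]mulrA -exprMn.
have -> : n%:R / (4 * k%:R) * (p * (C1 / 2 * expR (- tau))) =
    expR (ln (d * C1 / 8) - ln k%:R - tau).
  rewrite !expRD !expRN !lnK ?posrE ?divr_gt0 ?mulr_gt0// /p; field.
  by rewrite !gt_eqF// ?expR_gt0.
rewrite nL -expRM_natl -!expRD ler_expR.
have kt : k%:R * tau = (1 - delta) * (2 / alpha) * L.
  by rewrite /tau; field; rewrite !gt_eqF.
have lnk : ln k%:R <= M :> R.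
  have -> : M = ln L by rewrite LM expRK.
  by rewrite ler_ln// posrE.
have h1 : k%:R * ln k%:R <= k%:R * M :> R by rewrite ler_wpM2l.
have h2 : k%:R * M <= ka * L + M.
  have := ler_wpM2r (ltW M0) hk; rewrite mulrDl mul1r mulfVK ?gt_eqF//.
set W := L / M.
have LW : L = W * M by rewrite /W mulfVK ?gt_eqF.
have W1 : 2 * W >= M /\ 1 <= W.
  have : 1 + M ^+ 2 / 2 <= L by rewrite LM; exact: (expR_ge1Dxn 1 (ltW M0)).
  have : 1 + M <= L by rewrite LM; exact: expR_ge1Dx.
  rewrite /W ler_pdivlMr// mul1r => h h'; split; last by lra.
  by rewrite mulrA ler_pdivlMr//; move: h'; rewrite expr2; lra.
have [W2 W3] := W1.
set c0 := `|_| in hM; have c00 : 0 <= c0 by exact: normr_ge0.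
have hc0 : - c0 <= ln (d * C1 / 8) by rewrite lerNl /c0 -normrN ler_norm.
have h3 : k%:R * c0 <= (W + 1) * c0.
  rewrite ler_wpM2r//; apply: le_trans hk _; rewrite lerD2r -mulrA -/W.
  by rewrite ler_piMl//; [lra|rewrite /ka; lra].
have h4 : k%:R * - c0 <= k%:R * ln (d * C1 / 8) by rewrite ler_wpM2l.
have h5 := ler_wpM2r (le_trans ler01 W3) hM.
have h6 : delta * (2 / alpha) * M * W = delta * (2 / alpha) * L by rewrite LW; ring.
rewrite /ka in h2; rewrite h6 in h5.
have h7 : d <= d * W by rewrite ler_peMr// ltW.
have h8 : c0 <= c0 * W by rewrite ler_peMr.
lra.
Qed.

End NoStarRate.

Section FixedSize.
Local Open Scope classical_set_scope.
Local Open Scope ring_scope.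
Context {R : realType} {disp : measure_display} {T : measurableType disp}.
Context (P : probability T R) {n : nat} (d : R) (G : T -> rel 'I_n)
  (Y : T -> 'M[R]_n) (mu : probability (measurableTypeR R) R).
Hypotheses (hG : erdos_renyi P (d / n%:R) G) (hY : symmetric_iid_mx P mu Y)
  (hGY : independent_mx P (fun w => adjacency_mx (G w)) Y).

Lemma measurable_lambda1_sparse : (0 < n)%N ->
  measurable_fun setT (fun w => lambda1 (sparse_mx G Y w)).
Proof.
move=> n0; have [symG mG _ _] := hG; have [symY _ mY _ _] := hY.
apply: measurable_lambda1 => // [w|i j]; first exact: sparse_mx_sym.
have -> : (fun w => sparse_mx G Y w i j) = (fun w => if G w i j then Y w i j else 0).
  by apply/funext => w; rewrite sparse_mxE; case: (G w i j); rewrite ?mul1r ?mul0r.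
by apply: measurable_fun_ifT.
Qed.

Context (alpha C1 Cl L M delta eta kappa : R) (b r : nat).
Hypotheses (a2 : 2 < alpha) (d0 : 0 < d) (C10 : 0 < C1) (Cl0 : 0 < Cl).
Hypotheses (de01 : 0 < delta <= 1 / 2) (eta0 : 0 < eta) (kappa0 : 0 < kappa).
Hypotheses (nL : n%:R = expR L) (LM : L = expR M) (M8 : 8 <= M) (dn : 2 * d <= n%:R).
Hypothesis mu_level : forall N (a : 'I_N.+1), (0 < N)%N ->
  fine (mu (level alpha N @^-1` [set a])) <= Cl * expR (- a%:R).
Hypothesis mu_lower : forall t : R, 1 < t ->
  ((C1 / 2 * expR (- t `^ alpha))%:E <= mu [set x : R | (t <= x)%R])%E.
Hypotheses (hb : 6 + 2 * (d * expR 1) <= b%:R)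
  (hk : 8 * b%:R * eta `^ (1 - 2 / alpha) <= kappa ^+ 2)
  (hr : 12 <= eta * r%:R).
Hypotheses
  (large_row : 4 * (d * (Cl / (1 - expR (- (delta / 4))))) / delta <= expR (delta / 4 * M))
  (large_hub : 18 * d <= eta * expR (M / 3))
  (large_rest : (3 * r)%:R <= eta * L / M)
  (large_star : 2 * (4 + 2 * `|ln (d * C1 / 8)| + 2 * d) <= delta * (2 / alpha) * M)
  (large_weight : b%:R * (2 * L) `^ alpha^-1 <= kappa * scale alpha L M)
  (large_threshold : 4 < 2 / alpha * M).

(** Outside the event without star, a deviation of [lambda1] forces the marks not
    to be tame, whatever its direction. *)
Lemma lambda1_deviation_prob (eps : R) :
  delta * lim_const alpha + kappa < eps ->
  (P [set w | (eps <= `|M `^ (1 / 2 - 1 / alpha) / L `^ (1 / 2) *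
       lambda1 (sparse_mx G Y w) - lim_const alpha|)%R] <=
   ((d ^+ 6 + 6) * expR (- (delta * (2 / alpha) / 4 * L)))%:E)%E.
Proof.
move: (a2) (M8) (dn) (d0) (C10) (kappa0) (large_threshold) => ha2 hM8 hdn hd0 hC10 hkappa0 hbig6.
move=> heps; have [symG _ _ _] := hG; have [symY _ _ _ _] := hY.
have /andP[de0 de1] := de01.
have a0 : 0 < alpha by exact: lt_trans a2.
have th0 : 0 < 2 / alpha by rewrite divr_gt0.
have ka0 : 0 < 1 - 2 / alpha by rewrite subr_gt0 ltr_pdivrMr// mul1r.
have e1 : 0 < 1 - delta by lra.
have M0 : 0 < M by lra.
have L1 : 1 + M <= L by rewrite LM; exact: expR_ge1Dx.
have L2 : 1 + M ^+ 2 / 2 <= L by rewrite LM; exact: (expR_ge1Dxn 1 (ltW M0)).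
have L0 : 0 < L by lra.
have nR : 0 < n%:R :> R by rewrite nL expR_gt0.
have n0 : (0 < n)%N by rewrite -(ltr0n R).
have nL1 : 1 + L <= n%:R by rewrite nL; exact: expR_ge1Dx.
have b0 : (0 < b)%N.
  rewrite -(ltr0n R); apply: lt_le_trans hb.
  by rewrite ltr_wpDr// mulr_ge0// mulr_ge0 ?expR_ge0// ltW.
have sc0 := scale_gt0 alpha L0 M0.
have lim0 := lim_const_gt0 a2.
have p01 : 0 <= d / n%:R <= 1.
  by rewrite divr_ge0 ?(ltW d0) ?(ltW nR)//= ler_pdivrMr// mul1r; lra.
(* [k] is just above the optimal degree, and [t] is the common weight that
   spends on [k] edges the fraction [1 - delta] of the budget [2 L / alpha]. *)
pose k := (Num.trunc ((1 - 2 / alpha) * L / M)).+1.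
have kB : (1 - 2 / alpha) * L / M < k%:R <= (1 - 2 / alpha) * L / M + 1.
  have x0 : 0 <= (1 - 2 / alpha) * L / M by rewrite divr_ge0 ?mulr_ge0 ?ltW.
  by have /andP[x1 x2] := truncn_itv x0; rewrite x2 /= /k -natr1 lerD2r.
have /andP[kB1 kB2] := kB.
have k0 : 0 < k%:R :> R by rewrite ltr0n.
have LMM : L / M <= L / 8 by rewrite ler_wpM2l ?(ltW L0)// lef_pV2 ?posrE//.
have LM1 : 1 <= L / M by rewrite ler_pdivlMr// mul1r; lra.
have kLM : (1 - 2 / alpha) * L / M <= L / M.
  by rewrite -mulrA ger_pMl ?divr_gt0//; lra.
have kL : k%:R <= L by lra.
pose t := ((1 - delta) * (2 / alpha) * L / k%:R) `^ alpha^-1.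
have x1 : 1 < (1 - delta) * (2 / alpha) * L / k%:R.
  rewrite ltr_pdivlMr// mul1r; apply: le_lt_trans kB2 _.
  apply: (@lt_le_trans _ _ (1 / 2 * (2 / alpha) * L)); last first.
    by rewrite (ler_wpM2r (ltW L0))// (ler_wpM2r (ltW th0))//; lra.
  apply: le_lt_trans (_ : 2 * (L / M) < _); first lra.
  have : 4 * L < 2 / alpha * M * L by rewrite ltr_pM2r.
  rewrite mulrA ltr_pdivrMr//; lra.
have ta : t `^ alpha = (1 - delta) * (2 / alpha) * L / k%:R.
  by rewrite -powRrM mulVf ?gt_eqF// powRr1//; lra.
have t1 : 1 < t.
  have -> : 1 = 1 `^ alpha^-1 :> R by rewrite powR1.
  by rewrite gt0_ltr_powR ?invr_gt0 ?nnegrE//; lra.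
pose heavy (y : R) : bool := t <= y.
have mheavy f : measurable (heavy @^-1` [set f] : set (measurableTypeR R)).
  case: f.
    by have := @measurable_itv R `[t, +oo[; congr measurable; apply/seteqP;
      split => y /=; rewrite in_itv/= andbT.
  have := @measurable_itv R `]-oo, t[; congr measurable; apply/seteqP;
      split => y /=; rewrite in_itv/= /heavy ltNge; first by move=> /negbTE.
  by move=> ->.
have mn : (n./2.*2 <= n)%N by rewrite -{2}(odd_double_half n) leq_addl.
have [mNS PNS] := no_star_prob hG hY hGY p01 mheavy mn (Some true) k.
set NS := [set w | _] in mNS PNS.
have {}PNS : (P NS <= (expR (- (delta * (2 / alpha) / 4 * L)))%:E)%E.
  apply: le_trans PNS _; rewrite lee_fin ler_expR lerN2 /=.
  set q := fine _.
  have hq : 0 <= q <= 1.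
    rewrite fine_ge0//= -lee_fin fineK ?fin_num_measure//.
    exact: probability_le1.
  have qlow : C1 / 2 * expR (- ((1 - delta) * (2 / alpha) * L / k%:R)) <= q.
    rewrite -lee_fin fineK ?fin_num_measure// -ta.
    by have := mu_lower t1; congr (_ <= mu _)%E; apply/seteqP; split.
  have de1' : 0 < delta < 1 by rewrite de0 /= -subr_gt0.
  have L8 : 8 <= L by lra.
  apply: le_trans (no_star_rate a2 de1' d0 C10 M0 LM nL L8 dn _ kB2 kL large_star hq qlow) => //.
  apply: (@le_trans _ _ (1 + delta * (2 / alpha) * L / 2)); last exact: expR_ge1Dx.
  have : 0 <= delta * (2 / alpha) * L by rewrite ltW// mulr_gt0// mulr_gt0.
  lra.
set B := [set w | _].
have mB : measurable B.
  have ml := measurable_lambda1_sparse n0.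
  have mf : measurable_fun setT (fun w => `|M `^ (1 / 2 - 1 / alpha) / L `^ (1 / 2) *
       lambda1 (sparse_mx G Y w) - lim_const alpha|).
    apply: measurableT_comp => //; apply: measurable_funB => //.
    exact: measurable_funM.
  have := mf measurableT `[eps, +oo[%classic (measurable_itv _).
  by rewrite setTI; congr measurable; apply/seteqP; split => w /=; rewrite in_itv/= andbT.
pose N := n.*2.
have N0 : (0 < N)%N by rewrite double_gt0.
have LN : 2 * L < N%:R :> R by rewrite /N -mul2n natrM; lra.
have mlev (a : 'I_N.+1) : measurable (level alpha N @^-1` [set a] : set (measurableTypeR R)).
  exact: measurable_level.
have sub w : (B `\` NS) w -> ~ tame L M delta eta b r (sample_marks G Y (level alpha N) w).
  move=> [Bw /existsNP[c /negP]] + tw; rewrite -leqNgt.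
  set S0 := [set _ | _]%SET => kS0.
  pose S := (star_leaf mn @: S0)%SET.
  have cardS : #|S| = #|S0| by rewrite card_imset//; exact: star_leaf_inj.
  have SR : k%:R <= #|S|%:R :> R by rewrite ler_nat cardS.
  have de1' : 0 < delta < 1 by rewrite de0 /= -subr_gt0.
  have up := tame_lambda1_le symG symY a2 L0 M0 de1' eta0 LN n0 tw kappa0 b0 hk large_rest.
  have low : (1 - delta) * (lim_const alpha * scale alpha L M) -
      b%:R * (2 * L) `^ alpha^-1 <= lambda1 (sparse_mx G Y w).
    apply: (tame_lambda1_ge (c := star_center mn c) (S := S) symG symY a2 L0 M0 de1' LN tw).
    - by rewrite cardS; apply: leq_trans kS0.
    - by apply: le_trans SR; exact: ltW.
    - apply/imsetP => -[u _ /(congr1 val)/= cu].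
      by have := ltn_ord c; rewrite cu ltnNge leq_addr.
    - move=> _ /imsetP[u + ->]; rewrite inE /edge_mark /=.
      case: ifP => // Gu /eqP[tu]; split => //; apply: le_trans tu.
      have x0 : 0 <= (1 - delta) * (2 / alpha) * L.
        by rewrite ltW// mulr_gt0// mulr_gt0.
      rewrite ge0_ler_powR ?invr_ge0 ?nnegrE ?(ltW a0)//; try exact: divr_ge0.
      by rewrite ler_wpM2l// lef_pV2 ?posrE// (lt_le_trans k0).
  move: Bw; apply/negP; rewrite -ltNge.
  have -> : M `^ (1 / 2 - 1 / alpha) / L `^ (1 / 2) = (scale alpha L M)^-1.
    by rewrite /scale invf_div.
  rewrite ltr_norml; apply/andP; split.
    rewrite ltrBrDr mulrC ltr_pdivlMr//.
    apply: lt_le_trans low; rewrite ltrBrDr.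
    have : (delta * lim_const alpha + kappa) * scale alpha L M < eps * scale alpha L M.
      by rewrite ltr_pM2r.
    move: (large_weight); lra.
  rewrite ltrBlDr mulrC ltr_pdivrMr//; apply: le_lt_trans up _.
  by rewrite ltr_pM2r//; lra.
have pi0 f : 0 <= mark_pmf (d / n%:R) mu (level alpha N) f by exact: mark_pmf_ge0.
have pi1 := sum_mark_pmf (d / n%:R) mu mlev.
have pS := sum_mark_pmf_Some (d / n%:R) mu mlev.
have pn : (\sum_f mark_pmf (d / n%:R) mu (level alpha N) (Some f)) * n%:R = d.
  by rewrite pS divfK// gt_eqF.
have PB : (P (B `\` NS) <=
    ((d ^+ 6 + 5) * expR (- (delta * (2 / alpha) / 4 * L)))%:E)%E.
  apply: le_trans (prob_le_prodPr hG hY hGY mlev (measurableD mB mNS) sub) _.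
  rewrite lee_fin.
  have de1' : 0 < delta <= 1 by lra.
  apply: le_trans (not_tame_prob pi0 pi1 d0 n0 nL LM M0 pn Cl0 de1' eta0 _ large_row large_hub hr hb) _.
    move=> l; rewrite pS /= ler_wpM2l ?mu_level//.
    by case/andP: p01.
  rewrite ler_wpM2l ?addr_ge0 ?exprn_ge0 ?(ltW d0)// ler_expR lerN2.
  rewrite (ler_wpM2r (ltW L0))// (ler_wpM2r _)// ger_pMr//; lra.
apply: (@le_trans _ _ (P ((B `\` NS) `|` NS))).
  apply: le_measure; rewrite ?inE//.
    by apply: measurableU => //; exact: measurableD.
  by move=> w Bw; have [|] := pselect (NS w); [right|left].
apply: le_trans (measureU2 _ (measurableD mB mNS) mNS) _.
apply: le_trans (leeD PB PNS) _; rewrite -EFinD lee_fin.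
set x := expR _; have : 0 < x by rewrite expR_gt0.
lra.
Qed.
End FixedSize.

(** * The limit *)

Local Open Scope classical_set_scope.
Local Open Scope ring_scope.

Lemma cvge0_le (R : realType) (u : nat -> \bar R) :
  (forall n, 0 <= u n)%E ->
  (forall e : R, 0 < e -> \forall n \near \oo, (u n <= e%:E)%E) ->
  u n @[n --> \oo] --> 0%E.
Proof.
move=> u0 h; apply/fine_cvgP; split.
  apply: filterS (h 1 ltr01) => n un.
  by rewrite ge0_fin_numE//; apply: le_lt_trans un (ltry _).
apply/cvgr0Pnorm_le => e e0; apply: filterS (h e e0) => n un.
have fn : u n \is a fin_num by rewrite ge0_fin_numE//; apply: le_lt_trans un (ltry _).
by rewrite /= ger0_norm ?fine_ge0// -lee_fin fineK.
Qed.

Lemma cvg_lnln (R : realType) : ln (ln (n%:R : R)) @[n --> \oo] --> +oo%R.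
Proof.
apply/cvgryPge => A; apply: filterS (nbhs_infty_ger (expR (expR A))) => n hn.
have h1 : expR A <= ln n%:R.
  by rewrite -ler_expR lnK// posrE (lt_le_trans _ hn)// expR_gt0.
by rewrite -ler_expR lnK// posrE (lt_le_trans _ h1)// expR_gt0.
Qed.

(** The conditions under which [lambda1_deviation_prob] applies hold as soon as
    [M = ln (ln n)] is large, since [L = expR M] and [n = expR L]. *)
Lemma near_large (R : realType) (alpha d C1 Cl delta eta kappa e : R) (b r : nat) :
  2 < alpha -> 0 < d -> 0 < Cl -> 0 < delta <= 1 / 2 -> 0 < eta -> 0 < kappa -> 0 < e ->
  \forall M \near +oo%R, let L := expR M in
  [/\ [/\ 8 <= M, 2 * d <= expR L & 4 < 2 / alpha * M],
      4 * (d * (Cl / (1 - expR (- (delta / 4))))) / delta <= expR (delta / 4 * M),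
      18 * d <= eta * expR (M / 3) /\ (3 * r)%:R <= eta * L / M,
      2 * (4 + 2 * `|ln (d * C1 / 8)| + 2 * d) <= delta * (2 / alpha) * M /\
        b%:R * (2 * L) `^ alpha^-1 <= kappa * scale alpha L M &
      (d ^+ 6 + 6) * expR (- (delta * (2 / alpha) / 4 * L)) <= e].
Proof.
move=> a2 d0 Cl0 /andP[de0 de1] eta0 k0 e0.
have a0 : 0 < alpha by lra.
have th0 : 0 < 2 / alpha by rewrite divr_gt0.
have g0 : 0 < 1 / 2 - 1 / alpha.
  by rewrite subr_gt0 !div1r ltf_pV2 ?posrE.
have d60 : 0 < d ^+ 6 + 6 by rewrite ltr_wpDl ?exprn_ge0 ?(ltW d0).
near=> M.
have M8 : 8 <= M by near: M; exact: (nbhs_pinfty_ge (num_real _)).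
have M0 : 0 < M by lra.
pose L := expR M; rewrite -/L.
have L1 : 1 + M <= L by exact: expR_ge1Dx.
have L2 : 1 + M ^+ 2 / 2 <= L by exact: (expR_ge1Dxn 1 (ltW M0)).
have L0 : 0 < L by lra.
have LM : M / 2 <= L / M.
  by rewrite ler_pdivlMr//; move: L2; rewrite expr2; lra.
have LM0 : 0 < L / M by rewrite divr_gt0.
split.
- split=> //.
    have h : 2 * d <= M by near: M; exact: (nbhs_pinfty_ge (num_real _)).
    apply: le_trans h _; apply: (@le_trans _ _ L); first by lra.
    by apply: le_trans (expR_ge1Dx _); lra.
  by rewrite mulrC -ltr_pdivrMr//; near: M; exact: (nbhs_pinfty_gt (num_real _)).
- apply: le_trans (_ : delta / 4 * M <= _); last first.
    by apply: le_trans (expR_ge1Dx _); rewrite lerDr.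
  have de4 : 0 < delta / 4 by lra.
  by rewrite [leRHS]mulrC -ler_pdivrMr//; near: M; exact: (nbhs_pinfty_ge (num_real _)).
- split.
    rewrite [leRHS]mulrC -ler_pdivrMr//; apply: le_trans (_ : M / 3 <= _); last first.
      by apply: le_trans (expR_ge1Dx _); rewrite lerDr.
    by rewrite ler_pdivlMr//; near: M; exact: (nbhs_pinfty_ge (num_real _)).
  rewrite -mulrA [leRHS]mulrC -ler_pdivrMr//; apply: le_trans LM.
  by rewrite ler_pdivlMr//; near: M; exact: (nbhs_pinfty_ge (num_real _)).
- split.
    have c0 : 0 < delta * (2 / alpha) by rewrite mulr_gt0.
    by rewrite [leRHS]mulrC -ler_pdivrMr//; near: M; exact: (nbhs_pinfty_ge (num_real _)).
  have -> : kappa * scale alpha L M =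
      L `^ alpha^-1 * (kappa * (L / M) `^ (1 / 2 - 1 / alpha)).
    rewrite /scale -powRN !powR_expR// ln_div ?posrE// [RHS]mulrCA -!expRD.
    by congr (_ * expR _); field; rewrite gt_eqF.
  rewrite powRM// ?(ltW L0)// mulrCA mulrA [leLHS]mulrC ler_wpM2l ?powR_ge0//.
  rewrite [leRHS]mulrC -ler_pdivrMr//.
  set A := _ / kappa.
  have A0 : 0 <= A by rewrite divr_ge0 ?mulr_ge0 ?powR_ge0// ltW.
  have -> : A = (A `^ (1 / 2 - 1 / alpha)^-1) `^ (1 / 2 - 1 / alpha).
    by rewrite -powRrM mulVf ?gt_eqF// powRr1.
  rewrite ge0_ler_powR ?nnegrE ?powR_ge0 ?(ltW g0) ?(ltW LM0)//.
  apply: le_trans LM; rewrite ler_pdivlMr//; near: M; exact: (nbhs_pinfty_ge (num_real _)).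
- set c := delta * (2 / alpha) / 4.
  have c0 : 0 < c by rewrite divr_gt0// mulr_gt0.
  rewrite expRN ler_pdivrMr ?expR_gt0// [leRHS]mulrC -ler_pdivrMr//.
  apply: le_trans (expR_ge1Dx _).
  apply: le_trans (_ : c * M <= _); last first.
    have : c * M <= c * L by rewrite ler_wpM2l ?(ltW c0)//; lra.
    lra.
  by rewrite [leRHS]mulrC -ler_pdivrMr//; near: M; exact: (nbhs_pinfty_ge (num_real _)).
Unshelve. all: by end_near. Qed.

Theorem corollary1p3 (R : realType) (d alpha : R) (hd : 0 < d)
    (halpha : 2 < alpha)
    (mu : probability (measurableTypeR R) R) (hmu : weibull alpha mu)
    (disp : nat -> measure_display) (T : forall n, measurableType (disp n))
    (P : forall n, probability (T n) R)
    (G : forall n, T n -> rel 'I_n) (Y : forall n, T n -> 'M[R]_n)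
    (hG : forall n, d <= n%:R -> erdos_renyi (P n) (d / n%:R) (@G n))
    (hY : forall n, symmetric_iid_mx (P n) mu (@Y n))
    (hGY : forall n,
      independent_mx (P n) (fun w => adjacency_mx (@G n w)) (@Y n)) :
  cvg_in_probability P
    (fun n w =>
      ln (ln n%:R) `^ (1 / 2 - 1 / alpha) / ln n%:R `^ (1 / 2) *
      lambda1 (entrywise_mul (adjacency_mx (@G n w)) (@Y n w)))
    (2 `^ (1 / alpha) * alpha `^ (- (1 / 2)) *
     (alpha - 2) `^ (1 / 2 - 1 / alpha)).
Proof.
move=> eps eps0; rewrite -/(lim_const alpha).
have [Cl Cl0 hlev] := weibull_level hmu.
have [_ [C1 [C2 [C10 _ hC]]]] := hmu.
have hlow t : 1 < t -> ((C1 / 2 * expR (- t `^ alpha))%:E <= mu [set x : R | (t <= x)%R])%E.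
  by move=> /hC[/andP[]].
have lim0 := lim_const_gt0 halpha.
have ka0 : 0 < 1 - 2 / alpha by rewrite subr_gt0 ltr_pdivrMr// ?mul1r//; lra.
pose kappa := eps / 4; have kappa0 : 0 < kappa by rewrite divr_gt0.
pose delta := eps / (4 * (lim_const alpha + eps)).
have s0 : 0 < lim_const alpha + eps by rewrite addr_gt0.
have de01 : 0 < delta <= 1 / 2.
  by rewrite divr_gt0 ?mulr_gt0//= ler_pdivrMr ?mulr_gt0//; lra.
have heps : delta * lim_const alpha + kappa < eps.
  have : delta * lim_const alpha <= eps / 4.
    rewrite /delta mulrAC ler_pdivrMr ?mulr_gt0//.
    have := mulr_gt0 eps0 eps0; lra.
  rewrite /kappa; lra.
pose b := (Num.trunc (6 + 2 * (d * expR 1))).+1.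
have hb : 6 + 2 * (d * expR 1) <= b%:R.
  have x0 : 0 <= 6 + 2 * (d * expR 1) by rewrite addr_ge0// !mulr_ge0 ?expR_ge0// ltW.
  by have /andP[_ /ltW] := truncn_itv x0.
have bR : 0 < b%:R :> R by rewrite ltr0n.
pose eta := (kappa ^+ 2 / (8 * b%:R)) `^ (1 - 2 / alpha)^-1.
have etab : 0 < kappa ^+ 2 / (8 * b%:R) by rewrite divr_gt0 ?exprn_gt0 ?mulr_gt0.
have eta0 : 0 < eta by rewrite powR_gt0.
have hk : 8 * b%:R * eta `^ (1 - 2 / alpha) <= kappa ^+ 2.
  rewrite /eta -powRrM mulVf ?gt_eqF// powRr1 ?(ltW etab)//.
  by rewrite mulrC divfK// gt_eqF// mulr_gt0.
pose r := (Num.trunc (12 / eta)).+1.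
have hr : 12 <= eta * r%:R.
  have x0 : 0 <= 12 / eta by rewrite divr_ge0// ltW.
  by rewrite [leRHS]mulrC -ler_pdivrMr//; have /andP[_ /ltW] := truncn_itv x0.
apply: cvge0_le => [n|e e0]; first exact: measure_ge0.
have H := near_large C1 b r halpha hd Cl0 de01 eta0 kappa0 e0.
have [N1 _ hN1] := cvg_lnln H.
have [N2 _ hN2] := nbhs_infty_ger (expR 1 : R).
exists (maxn N1 N2) => // n /=; rewrite geq_max => /andP[/hN1/= Hn /hN2/= n1].
have nR : 0 < n%:R :> R by exact: lt_le_trans (expR_gt0 _) n1.
have ln1 : 1 <= ln n%:R :> R by rewrite -ler_expR lnK.
have LM : ln n%:R = expR (ln (ln n%:R)) :> R by rewrite lnK// posrE (lt_le_trans ltr01).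
have nL : n%:R = expR (ln n%:R) :> R by rewrite lnK.
move: Hn; rewrite -LM -nL => -[[M8 dn large_threshold] large_row [large_hub large_rest] [large_star large_weight] small].
have dn' : d <= n%:R by lra.
apply: le_trans (lambda1_deviation_prob (hG n dn') (hY n) (hGY n) halpha hd C10 Cl0 de01
  eta0 kappa0 nL LM M8 dn hlev hlow hb hk hr large_row large_hub large_rest large_star large_weight large_threshold heps) _.
by rewrite lee_fin.
Qed.
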